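(* Fix integers $\alpha\ge 0$, $m\ge 1$ with $\alpha+m\le n$, let $S=[\alpha+1,\alpha+m]$, and let $r$ be an integer with $0\le r<m$. A monomial $\mathbf m=\prod_{i=1}^d[\mathbf a^{(i)}]\in R(k,n)$ lies in $\operatorname{In}_\omega(\mathcal J_{S\le r})$ if and only if (1) for some $i,j\in[d]$ the sets $\mathbf a^{(i)}$ and $\mathbf a^{(j)}$ are incomparable in the Plücker poset, or (2) $\mathbf m$ is a standard monomial containing a generalized antidiagonal of size $r+1$ with entries in $S$. In particular, a monomial $\mathbf m$ is a minimal generator of $\operatorname{In}_\omega(\mathcal J_{S\le r})$ if and only if $\mathbf m$ satisfies (1) or (2) and every monomial strictly dividing $\mathbf m$ satisfies neither (1) nor (2).
   Context: Let $\Bbbk$ be an algebraically closed field of characteristic $0$ and fix integers $1\le k<n$. $\mathrm{Gr}(k,n)$ is the Grassmannian of $k$-dimensional subspaces of $\Bbbk^n$; a point $V$ is represented by a $k\times n$ matrix with row span $V$. For $\mathbf a=\{a_1<\dots<a_k\}\subseteq[n]$, $[\mathbf a]$ denotes the Plücker coordinate (the maximal minor on columns $\mathbf a$). $R(k,n)=\Bbbk[[\mathbf a]:\mathbf a\in\binom{[n]}{k}]$ is the polynomial ring with one variable per $k$-subset; for a subvariety $X\subseteq\mathrm{Gr}(k,n)$ its defining ideal is the homogeneous ideal of polynomials in $R(k,n)$ vanishing on $X$ under the Plücker embedding. The Plücker poset is $\binom{[n]}{k}$ with $\mathbf a\le\mathbf b$ iff $a_i\le b_i$ for all $i$. $<_\omega$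 is the degree reverse lexicographic monomial order on $R(k,n)$ with respect to an ordering of the variables that is a fixed linear extension of the Plücker poset (poset-larger variables are larger); $\operatorname{In}_\omega(\cdot)$ is the initial ideal. For $S\subseteq[n]$ and $r\ge0$, $X_{S\le r}=\{V\in\mathrm{Gr}(k,n):\text{the columns of a representing matrix indexed by }S\text{ span a space of dimension}\le r\}$ and $\mathcal J_{S\le r}\subseteq R(k,n)$ is its defining ideal. A standard monomial is a product $\prod_{i=1}^d[\mathbf a^{(i)}]$ of pairwise comparable variables, ordered so that $\mathbf a^{(1)}\le\dots\le\mathbf a^{(d)}$, with $\mathbf a^{(i)}=\{a^{(i)}_1<\dots<a^{(i)}_k\}$ (viewed as a semistandard $k\times d$ tableau whose $i$-th column is $\mathbf a^{(i)}$). A generalized antidiagonal of size $\ell$ with entries in $S=[\alpha+1,\alpha+m]$ of such a standard monomial is a sequence $a^{(\sigma_\ell)}_{\rho_1},a^{(\sigma_{\ell-1})}_{\rho_2},\dots,a^{(\sigma_1)}_{\rho_\ell}$ with $\alpha+1\le a^{(\sigma_\ell)}_{\rho_1}<a^{(\sigma_{\ell-1})}_{\rho_2}<\dots<a^{(\sigma_1)}_{\rho_\ell}\le\alpha+m$, $1\le\sigma_1\le\sigma_2\le\dots\le\sigma_\ell\le d$, and $1\le\rho_1<\rho_2<\dots<\rho_\ell\le k$. *)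

(* Defs.v *)
From HB Require Import structures.
From mathcomp Require Import all_boot all_order all_algebra.
From mathcomp Require Import mpoly.

Set Implicit Arguments.
Unset Strict Implicit.
Unset Printing Implicit Defensive.

Import GRing.Theory.
Local Open Scope ring_scope.

(* Conventions: [n] = {1,...,n} is modelled by 'I_n = {0,...,n-1}
   (the element i+1 of [n] is the ordinal with value i).  All comparisons
   between elements are order-preserving under this shift. *)

Definition ksub (n k : nat) := {A : {set 'I_n} | #|A| == k}.

Definition nvars (n k : nat) : nat := #|{: ksub n k}|.

(* The variable [a] of R(k,n) = {mpoly F[nvars n k]}. *)
Definition Pvar (n k : nat) (a : ksub n k) : 'I_(nvars n k) := enum_rank a.

Definition elems (n k : nat) (a : ksub n k) : seq nat :=
  sort leq [seq val x | x <- enum (val a)].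

Definition ent (n k : nat) (a : ksub n k) (i : nat) : nat := nth 0 (elems a) i.

Definition pl_le (n k : nat) (a b : ksub n k) : bool :=
  [forall i : 'I_k, ent a i <= ent b i]%N.

Definition pl_comparable (n k : nat) (a b : ksub n k) : bool :=
  pl_le a b || pl_le b a.

(* Submatrix of M on the columns given by naturals f j (all < n). *)
Definition colsub_nat (F : fieldType) (k n p : nat) (M : 'M[F]_(k, n))
  (f : 'I_p -> nat) : 'M[F]_(k, p) :=
  \matrix_(i < k, j < p)
     (match @insub nat (fun x => x < n)%N _ (f j) with
      | Some c => M i c | None => 0 end).

Definition pluck (F : fieldType) (k n : nat) (M : 'M[F]_(k, n)) (a : ksub n k) : F :=
  \det (colsub_nat M (fun j : 'I_k => ent a j)).

Definition pluckv (F : fieldType) (k n : nat) (M : 'M[F]_(k, n)) :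
  'I_(nvars n k) -> F := fun x => pluck M (enum_val x).

(* Columns indexed by S = [alpha+1, alpha+m] (0-based: alpha, ..., alpha+m-1). *)
Definition colS (F : fieldType) (k n : nat) (alpha m : nat) (M : 'M[F]_(k, n)) :
  'M[F]_(k, m) := colsub_nat M (fun j : 'I_m => (alpha + j)%N).

(* The defining ideal J_{S <= r}: polynomials vanishing on (the affine cone
   over) X_{S<=r} under the Plücker embedding. *)
Definition Jideal (F : fieldType) (n k alpha m r : nat)
  (f : {mpoly F[nvars n k]}) : Prop :=
  forall M : 'M[F]_(k, n), (\rank (colS alpha m M) <= r)%N ->
    f.@[pluckv M] = 0.

(* w is a linear extension of the Plücker poset (w ranks the variables:
   larger rank = larger variable). *)
Definition linext (n k : nat) (w : ksub n k -> nat) : Prop :=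
  injective w /\ forall a b : ksub n k, pl_le a b -> (w a <= w b)%N.

(* Degree reverse lexicographic order w.r.t. the variable order w:
   drl_lt w m1 m2  means  x^m1 <_omega x^m2. *)
Definition drl_lt (n k : nat) (w : ksub n k -> nat)
  (m1 m2 : 'X_{1..nvars n k}) : Prop :=
  (mdeg m1 < mdeg m2)%N \/
  (mdeg m1 = mdeg m2 /\
   exists a : ksub n k,
     (m2 (Pvar a) < m1 (Pvar a))%N /\
     forall b : ksub n k, (w b < w a)%N -> m1 (Pvar b) = m2 (Pvar b)).

Definition is_lead (F : fieldType) (n k : nat) (w : ksub n k -> nat)
  (f : {mpoly F[nvars n k]}) (m : 'X_{1..nvars n k}) : Prop :=
  m \in msupp f /\
  forall m', m' \in msupp f -> m' <> m -> drl_lt w m' m.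

Definition initial_ideal (F : fieldType) (n k : nat) (w : ksub n k -> nat)
  (J : {mpoly F[nvars n k]} -> Prop) (p : {mpoly F[nvars n k]}) : Prop :=
  exists (l : nat) (q : 'I_l -> {mpoly F[nvars n k]})
         (lm : 'I_l -> 'X_{1..nvars n k}),
    (forall i, exists f, J f /\ f != 0 /\ is_lead w f (lm i)) /\
    p = \sum_(i < l) q i * 'X_[lm i].

Definition colseq (n k : nat) (m : 'X_{1..nvars n k}) : seq (ksub n k) :=
  flatten [seq nseq (m (Pvar a)) a | a <- enum {: ksub n k}].

Definition cond1 (n k : nat) (m : 'X_{1..nvars n k}) : Prop :=
  exists a b : ksub n k,
    (0 < m (Pvar a))%N /\ (0 < m (Pvar b))%N /\ ~~ pl_comparable a b.

Definition standard (n k : nat) (m : 'X_{1..nvars n k}) : Prop :=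
  forall a b : ksub n k,
    (0 < m (Pvar a))%N -> (0 < m (Pvar b))%N -> pl_comparable a b.

(* The columns t = [a^(1); ...; a^(d)] (sorted) contain a generalized
   antidiagonal of size l with entries in S = [alpha+1, alpha+m].
   0-based: sig j = sigma_(j+1) - 1, rho j = rho_(j+1) - 1, and the
   (j+1)-th entry of the antidiagonal is a^(sigma_(l-j))_(rho_(j+1)). *)
Definition has_gad (n k : nat) (alpha m l : nat) (t : seq (ksub n k)) : Prop :=
  exists sig rho : nat -> nat,
    let e j := nth 0 (nth [::] (map (@elems n k) t) (sig (l.-1 - j)%N)) (rho j) in
    (forall j, j < l -> sig j < size t /\ rho j < k)%N /\
    (forall j, j.+1 < l -> sig j <= sig j.+1 /\ rho j < rho j.+1)%N /\
    (forall j, j < l -> alpha <= e j < alpha + m)%N /\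
    (forall j, j.+1 < l -> e j < e j.+1)%N.

Definition cond2 (n k : nat) (alpha m r : nat) (mo : 'X_{1..nvars n k}) : Prop :=
  standard mo /\
  exists t : seq (ksub n k),
    perm_eq t (colseq mo) /\ sorted (@pl_le n k) t /\ has_gad alpha m r.+1 t.

(* Main.v *)
Require Import Defs.
From HB Require Import structures.
From mathcomp Require Import all_boot all_order all_algebra all_fingroup.
From mathcomp Require Import mpoly zify.
From Stdlib Require Import Classical.

Set Implicit Arguments.
Unset Strict Implicit.
Unset Printing Implicit Defensive.
Import GRing.Theory.
Local Open Scope ring_scope.

(* Conditions (1) and (2) produce leading monomials by the same alternation.
   Take a family of entries e_0 < e_1 < ... of the tableau sitting in weakly
   decreasing columns and antisymmetrize the product of brackets over these
   entries: the result is alternating in the corresponding columns of the matrix,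
   so it vanishes when these are linearly dependent.  Exchanging entries between
   two columns makes the first modified column smaller in the Pluecker poset, so the
   original monomial leads.  For (1) use the k+1 entries
   b_1 < ... < b_i < a_i < ... < a_k, for (2) the antidiagonal.

   Conversely, by reduction it suffices that the standard monomials without such an
   antidiagonal are linearly independent on X_{S<=r}.  Parametrize by
   M_ij = sum_l a_il b_lj, with r labels l for the columns in S and one private label
   for each other column.  Without a generalized antidiagonal of size r+1 there is no
   chain of r+1 cells (i, entry) in S, strictly increasing in both coordinates, so
   the levels of the cells label them by antichains.  Consider the monomial in the a
   and b given by this labelling.  Among the fillings with the same row and column
   content in each label, the antichain labelling minimizes the number of cells in
   every south-east quadrant; among the terms of a product of brackets, the diagonal
   one maximizes it.  Hence for a tableau with the largest total quadrant count in
   the support, this monomial comes only from its own diagonal term. *)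

(** * Subsets of size [k] as increasing words, and the Pluecker order *)

Section KSubsets.
Variables n k : nat.
Implicit Types a b : ksub n k.

Lemma size_elems a : size (elems a) = k.
Proof. by rewrite size_sort size_map -cardE (eqP (valP a)). Qed.

Lemma sorted_elems a : sorted ltn (elems a).
Proof.
rewrite ltn_sorted_uniq_leq sort_uniq map_inj_uniq ?enum_uniq ?sort_sorted //.
exact: val_inj.
Qed.

Lemma ent_ltn a i : (i < k)%N -> (ent a i < n)%N.
Proof.
move=> ik; have: ent a i \in elems a by rewrite mem_nth ?size_elems.
by rewrite mem_sort => /mapP[x _ ->]; apply: ltn_ord.
Qed.

Lemma ent_mono a i j : (i < j)%N -> (j < k)%N -> (ent a i < ent a j)%N.
Proof.
move=> ij jk; apply: (sorted_ltn_nth ltn_trans) => //.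
- exact: sorted_elems.
- by rewrite inE size_elems (ltn_trans ij).
- by rewrite inE size_elems.
Qed.

Lemma ent_leq a i j : (i <= j)%N -> (j < k)%N -> (ent a i <= ent a j)%N.
Proof. by rewrite leq_eqVlt => /orP[/eqP -> //|ij jk]; exact/ltnW/ent_mono. Qed.

Definition ento a (i : 'I_k) : 'I_n := Ordinal (ent_ltn a (ltn_ord i)).

Lemma ento_mono a (i j : 'I_k) : (ento a i < ento a j)%N = (i < j)%N.
Proof.
apply/idP/idP => [|ij]; last exact: ent_mono.
by apply: contraLR; rewrite -!leqNgt => ij; apply: ent_leq.
Qed.

Lemma ento_leq a (i j : 'I_k) : (ento a i <= ento a j)%N = (i <= j)%N.
Proof. by rewrite leqNgt ento_mono -leqNgt. Qed.

Lemma ento_inj a : injective (ento a).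
Proof.
by move=> i j e; apply/val_inj/eqP; rewrite eqn_leq -!(ento_leq a) e leqnn.
Qed.

Lemma mem_ksubP a x : reflect (exists i, x = ento a i) (x \in val a).
Proof.
apply: (iffP idP) => [xa|[i ->]].
  have: val x \in elems a by rewrite mem_sort map_f // mem_enum.
  case/(nthP 0%N) => i; rewrite size_elems => ik e.
  by exists (Ordinal ik); apply: val_inj.
have: ent a i \in elems a by rewrite mem_nth ?size_elems.
rewrite mem_sort => /mapP[y]; rewrite mem_enum => ya e.
by rewrite (_ : ento _ _ = y) //; apply: val_inj.
Qed.

Lemma mem_ento a i : ento a i \in val a.
Proof. by apply/mem_ksubP; exists i. Qed.

Lemma ksub_subset_eq a b : val a \subset val b -> a = b.
Proof.
move=> ab; apply/val_inj/eqP.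
by rewrite eqEcard ab (eqP (valP a)) (eqP (valP b)) leqnn.
Qed.

Lemma ento_ext a b : ento a =1 ento b -> a = b.
Proof.
move=> e; apply: ksub_subset_eq; apply/subsetP => x /mem_ksubP[i ->].
by rewrite e mem_ento.
Qed.

Lemma inj_ksub (g : 'I_k -> 'I_n) : injective g ->
  exists (a : ksub n k) (s : 'S_k), forall i, g i = ento a (s i).
Proof.
move=> gi.
have ga : #|[set g i | i : 'I_k]| == k by rewrite card_imset // card_ord.
pose a : ksub n k := exist (fun A : {set 'I_n} => #|A| == k) _ ga.
have h i : exists j, g i = ento a j by apply/mem_ksubP; rewrite /= imset_f.
have [f fE] := fin_all_exists h.
have fi : injective f by move=> i j e; apply: gi; rewrite !fE e.
by exists a, (perm fi) => i; rewrite permE.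
Qed.

Lemma ento_perm_eq a b (s t : 'S_k) :
  (forall i, ento a (s i) = ento b (t i)) -> a = b /\ s = t.
Proof.
move=> e; have ab : a = b.
  apply: ksub_subset_eq; apply/subsetP => x /mem_ksubP[i ->].
  by rewrite -[i](permKV s) e mem_ento.
by split=> //; apply/permP => i; apply: (@ento_inj a); rewrite e ab.
Qed.

Lemma pl_leP a b : reflect (forall i, ento a i <= ento b i)%N (pl_le a b).
Proof. exact: forallP. Qed.

Lemma pl_le_refl a : pl_le a a.
Proof. exact/pl_leP. Qed.

Lemma pl_le_trans : transitive (@pl_le n k).
Proof. by move=> b a c /pl_leP h1 /pl_leP h2; apply/pl_leP => i; apply: leq_trans (h2 i). Qed.

(** If [ento b i < ento a i], the threshold [x = ento b i] is contradictory by counting: either the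
    elements of [b] in rows up to [i] would all lie in [a] in rows before [i], or the elements of
    [a] in rows from [i] on would all lie in [b] in rows after [i]. *)
Lemma pl_leW a b :
  (forall x : 'I_n,
     {in val b, forall y : 'I_n, (y <= x)%N -> y \in val a} \/
     {in val a, forall y : 'I_n, (x < y)%N -> y \in val b}) -> pl_le a b.
Proof.
move=> h; apply/pl_leP => i; rewrite leqNgt; apply/negP => lt_i.
have [hb|ha] := h (ento b i).
  have: [set ento b j | j : 'I_k & (j <= i)%N] \subset
        [set ento a j | j : 'I_k & (j < i)%N].
    apply/subsetP => x /imsetP[j]; rewrite inE => ji ->{x}.
    have /hb : ento b j \in val b by exact: mem_ento.
    rewrite ento_leq => /(_ ji) /mem_ksubP[j' e]; rewrite e imset_f // inE.
    by rewrite -(ento_mono a) -e (leq_ltn_trans _ lt_i) // ento_leq.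
  move/subset_leq_card; rewrite !card_imset; try exact: ento_inj.
  apply/negP; rewrite -ltnNge; apply: proper_card; apply/properP; split.
    by apply/subsetP => j; rewrite !inE; exact: ltnW.
  by exists i; rewrite !inE ?ltnn.
have: [set ento a j | j : 'I_k & (i <= j)%N] \subset
      [set ento b j | j : 'I_k & (i < j)%N].
  apply/subsetP => x /imsetP[j]; rewrite inE => ji ->{x}.
  have /ha : ento a j \in val a by exact: mem_ento.
  have lt_j : (ento b i < ento a j)%N by rewrite (leq_trans lt_i) // ento_leq.
  move=> /(_ lt_j) /mem_ksubP[j' e]; rewrite e imset_f // inE.
  by rewrite -(ento_mono b) -e.
move/subset_leq_card; rewrite !card_imset; try exact: ento_inj.
apply/negP; rewrite -ltnNge; apply: proper_card; apply/properP; split.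
  by apply/subsetP => j; rewrite !inE; exact: ltnW.
by exists i; rewrite !inE ?ltnn.
Qed.

End KSubsets.

(** * Minors and signed brackets of arbitrary column words *)

Section Minors.
Variables (n k : nat).

(** Stated over a commutative ring so that it also applies to a generic matrix of polynomials; [g]
    may be unsorted or have repetitions. *)
Definition cminor (R : comRingType) (M : 'M[R]_(k, n)) (g : 'I_k -> 'I_n) : R :=
  \det (\matrix_(i < k, j < k) M i (g j)).

Lemma pluckE (F : fieldType) (M : 'M[F]_(k, n)) a : pluck M a = cminor M (ento a).
Proof.
congr (\det _); apply/matrixP => i j; rewrite !mxE.
case: insubP => [c _ ce|]; last by rewrite ent_ltn.
by congr (M i _); apply: val_inj.
Qed.

Lemma cminor_perm (R : comRingType) (M : 'M[R]_(k, n)) g (s : 'S_k) :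
  cminor M (fun i => g (s i)) = (-1) ^+ s * cminor M g.
Proof.
rewrite /cminor.
rewrite (_ : \matrix_(i, j) M i (g (s j)) = col_perm s (\matrix_(i, j) M i (g j))).
  by rewrite col_permE det_mulmx det_perm odd_permV mulrC.
by apply/matrixP => i j; rewrite !mxE.
Qed.

Lemma cminor_noninj (R : comRingType) (M : 'M[R]_(k, n)) g :
  ~~ injectiveb g -> cminor M g = 0.
Proof.
case/injectivePn => x [y xy gxy]; rewrite /cminor -det_tr.
by apply: (determinant_alternate xy) => i; rewrite !mxE gxy.
Qed.

End Minors.

Section SignedVar.
Variables (n k : nat) (F : fieldType).
Local Notation pol := {mpoly F[nvars n k]}.

(* The bracket [g_1 ... g_k] of an arbitrary word: a variable up to sign, or 0. *)
Definition bracket (g : 'I_k -> 'I_n) : pol :=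
  \sum_(a : ksub n k) \sum_(s : 'S_k | [forall i, g i == ento a (s i)])
     (-1) ^+ s *: 'X_(Pvar a).

Lemma bracket_perm a (s : 'S_k) g : (forall i, g i = ento a (s i)) ->
  bracket g = (-1) ^+ s *: 'X_(Pvar a).
Proof.
move=> gE; rewrite /bracket (bigD1 a) //= (bigD1 s) /=; last first.
  by apply/forallP => i; rewrite gE.
rewrite big1 ?addr0 => [|t /andP[/forallP gt ts]]; last first.
  have [|_ e] := @ento_perm_eq _ _ a a s t; last by rewrite e eqxx in ts.
  by move=> i; rewrite -gE (eqP (gt i)).
rewrite big1 ?addr0 // => b ba; apply: big1 => t /forallP gt.
have [|e _] := @ento_perm_eq _ _ a b s t; last by rewrite e eqxx in ba.
by move=> i; rewrite -gE (eqP (gt i)).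
Qed.

Lemma bracket_noninj g : ~~ injectiveb g -> bracket g = 0.
Proof.
move=> /injectiveP gi; rewrite /bracket big1 // => a _; rewrite big_pred0 // => s.
apply/negP => /forallP gE; apply: gi => i j e.
apply: (@perm_inj _ s); apply: (@ento_inj _ _ a).
by rewrite -(eqP (gE i)) -(eqP (gE j)).
Qed.

Lemma bracketP g : bracket g = 0 \/
  exists a (s : 'S_k), (forall i, g i = ento a (s i)) /\
    bracket g = (-1) ^+ s *: 'X_(Pvar a).
Proof.
have [gi|] := boolP (injectiveb g); last by left; apply: bracket_noninj.
right; have [a [s e]] := inj_ksub (injectiveP _ gi).
by exists a, s; split=> //; apply: bracket_perm.
Qed.

Lemma bracket_ento a : bracket (ento a) = 'X_(Pvar a).
Proof.
rewrite (@bracket_perm a 1) => [|i]; last by rewrite perm1.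
by rewrite odd_perm1 scale1r.
Qed.

Lemma bracket_eval (M : 'M[F]_(k, n)) g : (bracket g).@[pluckv M] = cminor M g.
Proof.
have [gi|ngi] := boolP (injectiveb g); last first.
  by rewrite bracket_noninj // meval0 cminor_noninj.
have [a [s e]] := inj_ksub (injectiveP _ gi).
rewrite (bracket_perm e) mevalZ mevalXU /pluckv /Pvar enum_rankK pluckE -cminor_perm.
by congr (\det _); apply/matrixP => i j; rewrite !mxE e.
Qed.

Lemma bracket_tperm g h x y : x != y -> h =1 g \o tperm x y ->
  bracket h = - bracket g.
Proof.
move=> xy hE; have hg : injective h <-> injective g.
  split=> hi; last by apply: (eq_inj _ (fsym hE)); apply: inj_comp => //; apply: perm_inj.
  apply: (@eq_inj _ _ (h \o tperm x y)); first by apply: inj_comp => //; apply: perm_inj.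
  by move=> i; rewrite /= hE /= tpermK.
have [/injectiveP gi|/injectiveP ngi] := boolP (injectiveb g); last first.
  rewrite !bracket_noninj ?oppr0 //; first exact/injectiveP.
  by apply/injectiveP => /hg.
have [a [s e]] := inj_ksub gi.
rewrite (bracket_perm e) (@bracket_perm a (tperm x y * s)); last first.
  by move=> i; rewrite hE /= e permM.
by rewrite odd_mul_tperm xy signr_addb expr1 mulN1r scaleNr.
Qed.

End SignedVar.

Lemma mpolyX_sum (R : ringType) (n : nat) (I : Type) (r : seq I) (P : pred I)
    (G : I -> 'X_{1..n}) :
  'X_[\sum_(i <- r | P i) G i] = \prod_(i <- r | P i) 'X_[G i] :> {mpoly R[n]}.
Proof. by apply: (big_morph (fun u => 'X_[u])); [exact: mpolyXD|exact: mpolyX0]. Qed.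

(** * Monomials of column families and their comparison *)

Section Columns.
Variables (n k d : nat).

Definition mcols (T : 'I_d -> ksub n k) : 'X_{1..nvars n k} :=
  (\sum_c U_(Pvar (T c)))%MM.

Lemma Pvar_eq (a b : ksub n k) : (Pvar a == Pvar b) = (a == b).
Proof. exact: (inj_eq enum_rank_inj). Qed.

Lemma mcolsE T b : mcols T (Pvar b) = (\sum_c (T c == b))%N.
Proof. by rewrite mnm_sumE; apply: eq_bigr => c _; rewrite mnm1E Pvar_eq. Qed.

Lemma mdeg_mcols T : mdeg (mcols T) = d.
Proof. by rewrite mdeg_sum (eq_bigr (fun=> 1%N)) ?sum1_card ?card_ord // => c _; rewrite mdeg1. Qed.

(** Let [T' c1] be the least variable of [T'] among the columns from [c0] on. It lies below every
    [T c] with [c0 <= c], so its exponent is larger in [T'], while smaller variables occur only in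
    the common columns before [c0]. *)
Lemma drl_mcols w (T T' : 'I_d -> ksub n k) (c0 : 'I_d) :
  (forall c c' : 'I_d, (c <= c')%N -> (w (T c) <= w (T c'))%N) ->
  (forall c : 'I_d, (c < c0)%N -> T' c = T c) -> (w (T' c0) < w (T c0))%N ->
  drl_lt w (mcols T') (mcols T).
Proof.
move=> wT eqT ltT; right; split; first by rewrite !mdeg_mcols.
have [c1 c01 c1min] := @arg_minnP _ c0 (fun c : 'I_d => c0 <= c)%N (fun c => w (T' c)) (leqnn c0).
have lt1 (c : 'I_d) : (c0 <= c)%N -> (w (T' c1) < w (T c))%N.
  move=> cc; apply: leq_ltn_trans (c1min c0 (leqnn _)) _.
  by apply: leq_trans ltT _; apply: wT.
exists (T' c1); split.
  rewrite !mcolsE (bigD1 c1) //= [X in (_ < X)%N](bigD1 c1) //= eqxx.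
  have /negPf -> : T c1 != T' c1 by apply: contraTneq (lt1 _ c01) => ->; rewrite ltnn.
  rewrite add0n add1n ltnS; apply: leq_sum => c _.
  have [cc|cc] := ltnP c c0; first by rewrite (eqT c).
  by have /negPf -> : T c != T' c1 by apply: contraTneq (lt1 _ cc) => ->; rewrite ltnn.
move=> b wb; rewrite !mcolsE; apply: eq_bigr => c _.
have [cc|cc] := ltnP c c0; first by rewrite (eqT c).
have /negPf -> : T c != b.
  by apply: contraTneq (lt1 _ cc) => ->; rewrite -leqNgt ltnW.
by have /negPf -> : T' c != b by apply: contraTneq (c1min _ cc) => ->; rewrite -ltnNge.
Qed.

End Columns.

(** * Antisymmetrization over chosen entries and its leading monomial *)

Section Alternation.
Variables (F : fieldType) (n k d l : nat) (w : ksub n k -> nat).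
Hypotheses (charF0 : [pchar F] =i pred0) (hw : linext w).
Variables (T : 'I_d -> ksub n k) (pos : 'I_l -> 'I_d * 'I_k).
Local Notation pcol j := (pos j).1.
Local Notation prow j := (pos j).2.
Local Notation E j := (ento (T (pcol j)) (prow j)).
Hypotheses (wT : forall c c' : 'I_d, (c <= c')%N -> (w (T c) <= w (T c'))%N)
  (E_mono : forall j j' : 'I_l, (j < j')%N -> (E j < E j')%N)
  (pcol_mono : forall j j' : 'I_l, (j < j')%N -> (pcol j' <= pcol j)%N).

Lemma E_inj j j' : E j = E j' -> j = j'.
Proof.
move=> e; apply: val_inj; case: (ltngtP j j') => // /E_mono; by rewrite e ltnn.
Qed.

Lemma pos_inj : injective pos.
Proof. by move=> j j' e; apply: E_inj; rewrite e. Qed.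

Lemma E_ltn j j' : (pcol j < pcol j')%N -> (E j' < E j)%N.
Proof.
move=> lt; apply: E_mono; rewrite ltnNge leq_eqVlt; apply/negP => /orP[/eqP/val_inj e|].
  by rewrite e ltnn in lt.
by move/pcol_mono; rewrite leqNgt lt.
Qed.

(** The chosen entries are permuted among their positions. The resulting column may be unsorted or
    have repetitions, which is why [bracket] accepts any word. *)
Definition altcol (p : 'S_l) (c : 'I_d) (q : 'I_k) : 'I_n :=
  if [pick j | pos j == (c, q)] is Some j then E (p j) else ento (T c) q.

Lemma altcol_pos p j : altcol p (pcol j) (prow j) = E (p j).
Proof.
rewrite /altcol; case: pickP => [j' /eqP e|/(_ j)]; last by rewrite -surjective_pairing eqxx.
by rewrite (pos_inj (etrans e (esym (surjective_pairing _)))).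
Qed.

Lemma altcol_out p c q : (forall j, pos j != (c, q)) -> altcol p c q = ento (T c) q.
Proof. by rewrite /altcol; case: pickP => // j e /(_ j); rewrite e. Qed.

Lemma altcolP p c q : (exists2 j, pos j = (c, q) & altcol p c q = E (p j)) \/
  (forall j, pos j != (c, q)) /\ altcol p c q = ento (T c) q.
Proof.
have [/existsP[j /eqP e]|/existsPn h] := boolP [exists j, pos j == (c, q)].
  by left; exists j => //; rewrite -altcol_pos e.
by right; split=> //; apply: altcol_out.
Qed.

Lemma altcol1 c q : altcol 1 c q = ento (T c) q.
Proof. by case: (altcolP 1 c q) => [[j e ->]|[_ ->]] //; rewrite perm1 e. Qed.

Definition altpoly : {mpoly F[nvars n k]} :=
  \sum_(p : 'S_l) (-1) ^+ p *: \prod_c bracket F (altcol p c).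

(** Leibniz expansion of all minors assigns to each cell a row of [M], through permutations [h] that
    do not depend on [p]. For fixed [h] the sum over [p] is a multiple of the determinant of a
    square matrix whose rows are taken from the rank-deficient one. *)
Lemma altpoly_eval (M : 'M[F]_(k, n)) :
  (\rank (\matrix_(i < k, j < l) M i (E j)) < l)%N -> altpoly.@[pluckv M] = 0.
Proof.
move=> rkM; rewrite raddf_sum /=.
under eq_bigr => p _.
  rewrite mevalZ rmorph_prod /=.
  under eq_bigr => c _.
    rewrite bracket_eval /cminor -det_tr /determinant.
    under eq_bigr => s _ do under eq_bigr => i _ do rewrite !mxE.
    over.
  rewrite bigA_distr_bigA /= mulr_sumr.
  over.
rewrite exchange_big /= big1 // => h _.
(* [C] collects the signs of [h] and the factors from unchosen cells; neither depends on [p]. *)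
pose C := (\prod_c (-1) ^+ h c) *
  \prod_(x | x \notin [set pos j | j : 'I_l]) M (h x.1 x.2) (ento (T x.1) x.2).
pose N := \matrix_(j < l, j' < l) M (h (pcol j) (prow j)) (E j').
transitivity (\sum_(p : 'S_l) C * ((-1) ^+ p * \prod_j N j (p j))).
  apply: eq_bigr => p _.
  rewrite big_split /= pair_bigA /= (bigID (mem [set pos j | j : 'I_l])) /=.
  rewrite big_imset /=; last by move=> ? ? _ _; exact: pos_inj.
  rewrite [X in _ * (_ * (_ * X))](eq_bigr (fun x => M (h x.1 x.2) (ento (T x.1) x.2))); last first.
    move=> [c q] /= nx; rewrite altcol_out // => j; apply: contraNneq nx => <-.
    by rewrite imset_f.
  rewrite (eq_bigr (fun j => N j (p j))) => [|j _]; last by rewrite altcol_pos mxE.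
  rewrite /C; set a := \prod_c _; set b := \prod_(x | _) _; set e := \prod_j _.
  by rewrite mulrCA -mulrA [b * _]mulrCA [b * _]mulrC.
rewrite -mulr_sumr -/(\det N); suff -> : \det N = 0 by rewrite mulr0.
apply/eqP; apply: contraTT rkM => dN; rewrite -leqNgt.
have rN : \rank N = l by apply: mxrank_unit; rewrite unitmxE unitfE.
apply: leq_trans (_ : \rank N <= _)%N; first by rewrite rN.
rewrite (_ : N = rowsub (fun j => h (pcol j) (prow j)) (\matrix_(i < k, j < l) M i (E j))).
  by rewrite rowsubE mxrankM_maxr.
by apply/matrixP => i j; rewrite !mxE.
Qed.

Definition keeps_cols (p : 'S_l) := [forall j, pcol (p j) == pcol j].

(** Induction on the number of points moved. Composing [p] with a transposition that makes [j] fixed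
    swaps two entries inside one column, so exactly one bracket changes sign. *)
Lemma prod_bracket_keeps p : keeps_cols p ->
  \prod_c bracket F (altcol p c) = (-1) ^+ p *: 'X_[mcols T].
Proof.
have [m] := ubnP #|[set j | p j != j]|; elim: m p => // m IHm p; rewrite ltnS => pm kp.
have [/existsP[j pj]|/existsPn p1] := boolP [exists j, p j != j]; last first.
  have -> : p = 1%g by apply/permP => j; rewrite perm1; apply/eqP/negbNE.
  rewrite odd_perm1 scale1r /mcols mpolyX_sum; apply: eq_bigr => c _.
  by rewrite -bracket_ento; apply: eq_bigr => a _; apply: eq_bigl => s;
     apply: eq_forallb => q; rewrite altcol1.
pose j' := p^-1%g j; pose p' : 'S_l := (tperm j j' * p)%g.
have pj' : p j' = j by rewrite permKV.
have jj' : j != j' by apply: contra_neq pj => e; rewrite {1}e.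
have cjj' : pcol j' = pcol j by rewrite -[in RHS]pj' (eqP (forallP kp j')).
have kp' : keeps_cols p'.
  apply/forallP => x; rewrite permM (eqP (forallP kp _)).
  by case: tpermP => [->|->|]; rewrite ?cjj'.
have {}pm : (#|[set j | p' j != j]| < m)%N.
  apply: leq_trans pm; apply: proper_card; apply/properP; split.
    apply/subsetP => x; rewrite !inE permM; apply: contra_neq => px.
    case: tpermP => [xj|xj|//]; first by rewrite xj pj'.
    by move: px jj'; rewrite xj pj' => /eqP e /negP[].
  by exists j; rewrite !inE // permM tpermL pj' eqxx.
have := IHm _ pm kp'; rewrite odd_mul_tperm jj' signr_addb expr1 mulN1r scaleNr => IH.
apply: oppr_inj; rewrite -IH.
rewrite (bigD1 (pcol j)) //= [RHS](bigD1 (pcol j)) //= -mulNr; congr (_ * _).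
  rewrite -(@bracket_tperm _ _ _ _ (altcol p' (pcol j)) (prow j) (prow j')) //.
    apply: contra jj' => /eqP e; apply/eqP/pos_inj.
    by rewrite [LHS]surjective_pairing [RHS]surjective_pairing e cjj'.
  move=> q /=; case: tpermP => [->|->|nq nq'].
  - by rewrite altcol_pos -cjj' altcol_pos permM tpermL.
  - by rewrite altcol_pos -{1}cjj' altcol_pos permM tpermR.
  case: (altcolP p (pcol j) q) => [[x ex ->]|[h ->]]; last by rewrite altcol_out.
  have -> : pcol j = pcol x by rewrite ex.
  have -> : q = prow x by rewrite ex.
  rewrite altcol_pos permM tpermD //; first by apply: contra_not_neq nq => ->; rewrite ex.
  by apply: contra_not_neq nq' => ->; rewrite ex.
apply: eq_bigr => c cj; apply: eq_bigr => a _; apply: eq_bigl => s.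
apply: eq_forallb => q; congr (_ == _).
case: (altcolP p c q) => [[x ex ->]|[h ->]]; last by rewrite altcol_out.
have [-> ->] : c = pcol x /\ q = prow x by rewrite ex.
rewrite altcol_pos permM tpermD //.
  by apply: contra_neq cj => ->; rewrite ex.
by apply: contra_neq cj; rewrite -cjj' => ->; rewrite ex.
Qed.

(** Take the leftmost column [c0] that receives an entry from another column. Columns to its left
    keep their content, so the new entries come from the right and are smaller than every chosen
    entry of [c0]; hence column [c0] decreases. *)
Lemma drl_altcol p (T' : 'I_d -> ksub n k) (s : 'I_d -> 'S_k) :
  (forall c q, altcol p c q = ento (T' c) (s c q)) -> ~~ keeps_cols p ->
  drl_lt w (mcols T') (mcols T).
Proof.
move=> T'E /forallPn[j0 nj0].
pose bad (c : 'I_d) := [exists j, (pcol j == c) && (pcol (p j) != c)].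
have bad0 : bad (pcol j0) by apply/existsP; exists j0; rewrite eqxx.
have [c0 /existsP[j1 /andP[/eqP cj1 pj1]] c0min] := @arg_minnP _ (pcol j0) bad val bad0.
have good j : (pcol j < c0)%N -> pcol (p j) = pcol j.
  move=> jc; apply/eqP/negbNE/negP => nj; move: jc; rewrite ltnNge c0min //.
  by apply/existsP; exists j; rewrite eqxx.
have goodV j : (pcol (p j) < c0)%N -> pcol (p j) = pcol j.
  (* [p] maps the chosen positions [B] of a column left of [c0] into [B], hence onto it, so nothing
     from outside [B] lands there. *)
  move=> jc; pose B := [set x | pcol x == pcol (p j)].
  have pB : p @: B = B.
    apply/eqP; rewrite eqEcard card_imset ?leqnn ?andbT; last exact: perm_inj.
    by apply/subsetP => x /imsetP[y]; rewrite !inE => /eqP yB ->; rewrite good yB.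
  have : p j \in p @: B by rewrite pB inE.
  by case/imsetP => y; rewrite inE => /eqP yB /perm_inj e; rewrite [in RHS]e yB.
have geq j : (c0 <= pcol j)%N -> (c0 <= pcol (p j))%N.
  by move=> cj; rewrite leqNgt; apply/negP => lt; move: cj; rewrite -goodV // leqNgt lt.
have T'mem c x : x \in val (T' c) -> exists q, x = altcol p c q.
  by case/mem_ksubP => i ->; exists ((s c)^-1%g i); rewrite T'E permKV.
have memT' c q : altcol p c q \in val (T' c) by rewrite T'E mem_ento.
apply: (@drl_mcols _ _ _ _ _ _ c0) => // [c cc|].
  apply: ksub_subset_eq; apply/subsetP => x /T'mem[q ->].
  case: (altcolP p c q) => [[j ej ->]|[_ ->]]; last exact: mem_ento.
  have cj : pcol j = c by rewrite ej.
  have <- : pcol (p j) = c by rewrite good cj.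
  exact: mem_ento.
have lt1 : (c0 < pcol (p j1))%N.
  by rewrite ltn_neqAle eq_sym (inj_eq val_inj) pj1 geq // cj1.
rewrite ltn_neqAle; apply/andP; split; last first.
  apply: hw.2; apply: pl_leW => x.
  (* If some chosen entry of [c0] is at most [x], every entry received from another column is below
     [x]; otherwise all entries of [T c0] up to [x] are unchosen and stay in place. *)
  have [/existsP[j /andP[/eqP cj jx]]|/existsPn nj] :=
      boolP [exists j, (pcol j == c0) && (E j <= x)%N].
    right=> y /T'mem[q ->].
    case: (altcolP p c0 q) => [[j' ej' ->]|[_ ->] _]; last exact: mem_ento.
    have cj' : pcol j' = c0 by rewrite ej'.
    have [<- _|ne] := eqVneq (pcol (p j')) c0; first exact: mem_ento.
    have /E_ltn lt : (pcol j < pcol (p j'))%N.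
      by rewrite cj ltn_neqAle eq_sym (inj_eq val_inj) ne geq // cj'.
    by rewrite ltnNge (ltnW (leq_trans lt jx)).
  left=> y /mem_ksubP[q ->] qx; rewrite -(@altcol_out p) ?memT' // => j.
  by apply: contraTneq qx => ej; have := nj j; rewrite ej eqxx.
(* Strictness: were the columns equal, the received entry [E (p j1)] would already be in [T c0]. It
   is not a chosen entry there, and an unchosen one would then occur twice in the new column. *)
apply: contra_neq pj1 => /hw.1 e.
have : E (p j1) \in val (T c0) by rewrite -e -altcol_pos cj1 memT'.
case/mem_ksubP => q eq.
case: (altcolP p c0 q) => [[j ej _]|[h hq]].
  have cj : pcol j = c0 by rewrite ej.
  have qj : prow j = q by rewrite ej.
  by move: eq; rewrite -cj -qj => /E_inj ->.
have eqq : altcol p c0 q = altcol p c0 (prow j1) by rewrite hq -{2}cj1 altcol_pos eq.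
move: eqq; rewrite !T'E => /ento_inj/perm_inj qe.
by have := h j1; rewrite qe -cj1 -surjective_pairing eqxx.
Qed.

(** Each column-preserving permutation contributes coefficient 1, its sign occurring twice, so the
    total is their number, nonzero in characteristic 0. All other permutations give smaller
    monomials. *)
Lemma altpoly_lead : is_lead w altpoly (mcols T).
Proof.
have coefT p : ~~ keeps_cols p -> forall u,
    u \in msupp (\prod_c bracket F (altcol p c)) -> drl_lt w u (mcols T).
  move=> np u.
  have [/existsP[c /eqP z]|/existsPn nz] := boolP [exists c, bracket F (altcol p c) == 0].
    by rewrite (bigD1 c) //= z mul0r msupp0.
  have h c : exists as_ : ksub n k * 'S_k, (forall i, altcol p c i = ento as_.1 (as_.2 i))
      /\ bracket F (altcol p c) = (-1) ^+ as_.2 *: 'X_(Pvar as_.1).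
    case: (bracketP F (altcol p c)) => [z|[a [s e]]]; last by exists (a, s).
    by have := nz c; rewrite z eqxx.
  have [f fE] := fin_all_exists h.
  rewrite (eq_bigr _ (fun c _ => (fE c).2)) scaler_prod -mpolyX_sum.
  rewrite msuppMCX ?inE; last by apply/prodf_neq0 => c _; rewrite signr_eq0.
  move=> /eqP ->; apply: (@drl_altcol p (fun c => (f c).1) (fun c => (f c).2)) => //.
  by move=> c q; apply: (fE c).1.
have irr u : ~ drl_lt w u u.
  by case=> [|[_ [a []]]]; rewrite ltnn.
split.
  rewrite mcoeff_msupp raddf_sum /= (bigID keeps_cols) /=.
  rewrite [X in _ + X]big1 ?addr0 => [|p np]; last first.
    rewrite mcoeffZ memN_msupp_eq0 ?mulr0 //.
    by apply/negP => /(coefT _ np) /irr.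
  rewrite (eq_bigr (fun=> 1)) => [|p kp]; last first.
    by rewrite prod_bracket_keeps // mcoeffZ mcoeffZ mcoeffX eqxx mulr1 -expr2 sqrr_sign.
  rewrite sumr_const ((pcharf0P F).1 charF0) -lt0n; apply/card_gt0P; exists 1%g.
  by apply/forallP => j; rewrite perm1.
move=> u /msupp_sum_le /flattenP[_ /mapP[p _ ->]] /msuppZ_le up une.
have [kp|np] := boolP (keeps_cols p); last exact: coefT up.
move: up; rewrite prod_bracket_keeps // => /msuppZ_le.
by rewrite msuppX inE => /eqP.
Qed.
End Alternation.

(** * Conditions (1) and (2) give leading monomials *)

Lemma mono_upto (R : rel nat) (f : nat -> nat) l : transitive R ->
  (forall j, (j.+1 < l)%N -> R (f j) (f j.+1)) ->
  forall i j, (i < j)%N -> (j < l)%N -> R (f i) (f j).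
Proof.
move=> Rt Rf i; elim=> // j IHj; rewrite ltnS leq_eqVlt => /orP[/eqP -> /Rf //|ij jl].
exact: Rt (IHj ij (ltnW jl)) (Rf _ jl).
Qed.

Section LeadMonomials.
Variables (F : fieldType) (n k : nat) (w : ksub n k -> nat).
Hypotheses (charF0 : [pchar F] =i pred0) (hw : linext w).

Lemma count_colseq (mo : 'X_{1..nvars n k}) a :
  count_mem a (colseq mo) = mo (Pvar a).
Proof.
rewrite /colseq count_flatten -map_comp sumnE big_map big_enum /= (bigD1 a) //=.
rewrite count_nseq /= eqxx mul1n big1 ?addn0 // => b /negPf ba.
by rewrite count_nseq /= ba mul0n.
Qed.

Lemma mem_colseq (mo : 'X_{1..nvars n k}) a : (a \in colseq mo) = (0 < mo (Pvar a))%N.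
Proof. by rewrite -has_pred1 has_count count_colseq. Qed.

Lemma mcols_colseq (mo : 'X_{1..nvars n k}) t : perm_eq t (colseq mo) ->
  mcols (tnth (in_tuple t)) = mo.
Proof.
move=> pt; apply/mnmP => i; rewrite -(enum_valK i) -/(Pvar _) mcolsE.
set a := enum_val i.
rewrite -count_colseq -(seq.permP pt) -sum1_count [RHS]big_tnth [RHS]big_mkcond.
by apply: eq_bigr => c _ /=; case: (_ == a).
Qed.

Lemma colsub_rank p q (M : 'M[F]_(k, p)) (h : 'I_q -> 'I_p) :
  (\rank (colsub h M) <= \rank M)%N.
Proof.
rewrite -mxrank_tr -[leqRHS]mxrank_tr (_ : (colsub h M)^T = rowsub h M^T).
  by rewrite rowsubE mxrankM_maxr.
by apply/matrixP => i j; rewrite !mxE.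
Qed.

Lemma colSE alpha m (M : 'M[F]_(k, n)) i (j : 'I_m) (c : 'I_n) :
  c = (alpha + j)%N :> nat -> colS alpha m M i j = M i c.
Proof.
move=> ce; rewrite mxE; case: insubP => [c' _ c'e|]; last by rewrite -ce ltn_ord.
by congr (M i _); apply: val_inj; rewrite c'e -ce.
Qed.

Lemma cond2_lead alpha m r mo : cond2 alpha m r mo ->
  exists f, Jideal (F := F) alpha m r f /\ is_lead w f mo.
Proof.
case=> _ [t [pt [st [sig [rho /= [bnd [mon [inS inc]]]]]]]].
have c0 (j : 'I_r.+1) : (sig (r - j) < size t)%N.
  by apply: (bnd _ _).1; rewrite ltnS leq_subr.
(* Positions are listed by increasing entry, hence from right to left, whereas [sig] runs from left
   to right. *)
pose pos (j : 'I_r.+1) : 'I_(size t) * 'I_k :=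
  (Ordinal (c0 j), Ordinal (bnd j (ltn_ord j)).2).
pose T := tnth (in_tuple t).
pose e j := nth 0%N (nth [::] [seq elems i | i <- t] (sig (r - j)%N)) (rho j).
have EE (j : 'I_r.+1) : ento (T (pos j).1) (pos j).2 = e j :> nat.
  have a0 := T (pos j).1.
  rewrite /e (nth_map a0) //= /ent; congr (nth _ (elems _) _).
  by rewrite /T (tnth_nth a0).
have wT (c c' : 'I_(size t)) : (c <= c')%N -> (w (T c) <= w (T c'))%N.
  move=> cc; apply: hw.2; rewrite /T !(tnth_nth (T c)).
  by apply: (sorted_leq_nth (@pl_le_trans n k) (@pl_le_refl n k)); rewrite ?inE.
have E_mono (j j' : 'I_r.+1) : (j < j')%N ->
    (ento (T (pos j).1) (pos j).2 < ento (T (pos j').1) (pos j').2)%N.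
  by move=> jj; rewrite !EE; apply: (mono_upto ltn_trans inc).
have c_mono (j j' : 'I_r.+1) : (j < j')%N -> ((pos j').1 <= (pos j).1)%N.
  move=> jj /=; have := ltn_ord j'; have := ltn_ord j => jr jr'.
  apply: (mono_upto leq_trans (fun x h => (mon x h).1)); lia.
exists (altpoly F T pos); split; last first.
  by rewrite -(mcols_colseq pt); apply: altpoly_lead.
move=> M rkM; apply: altpoly_eval => //.
rewrite ltnS; apply: leq_trans rkM.
have eS (j : 'I_r.+1) : (alpha <= e j < alpha + m)%N by apply: inS.
have hb (j : 'I_r.+1) : (e j - alpha < m)%N by have := eS j; lia.
pose h j := Ordinal (hb j).
rewrite (_ : \matrix_(i, j) _ = colsub h (colS alpha m M)) ?colsub_rank //.
apply/matrixP => i j; rewrite [LHS]mxE [RHS]mxE.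
apply/esym/colSE; rewrite EE /=.
by have := eS j; lia.
Qed.

Lemma leqw_trans : transitive (relpre w leq).
Proof. by move=> ? ? ?; exact: leq_trans. Qed.

Lemma leqw_total : total (relpre w leq).
Proof. by move=> ? ?; exact: leq_total. Qed.

(** Sorting by [w] is possible for every monomial, as [pl_le] is only partial; without incomparable
    columns the result is also sorted for [pl_le]. *)
Definition wcols (mo : 'X_{1..nvars n k}) := sort (relpre w leq) (colseq mo).

Lemma perm_wcols mo : perm_eq (wcols mo) (colseq mo).
Proof. exact/permPl/perm_sort. Qed.

Lemma wcols_mono mo a0 c c' : (c <= c')%N -> (c' < size (wcols mo))%N ->
  (w (nth a0 (wcols mo) c) <= w (nth a0 (wcols mo) c'))%N.
Proof.
move=> cc cs.
have sw : sorted (relpre w leq) (wcols mo) by apply: sort_sorted; exact: leqw_total.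
have rw : reflexive (relpre w leq) by move=> ?; apply: leqnn.
by apply: (sorted_leq_nth leqw_trans rw a0 sw); rewrite ?inE ?(leq_ltn_trans cc).
Qed.

Lemma cond1_lead alpha m r mo : cond1 mo ->
  exists f, Jideal (F := F) alpha m r f /\ is_lead w f mo.
Proof.
case=> a [b [ma [mb]]].
wlog wab : a b ma mb / (w a <= w b)%N.
  move=> H nab; case: (leqP (w a) (w b)) => [/H|/ltnW /H]; apply=> //.
  by rewrite /pl_comparable orbC.
rewrite negb_or => /andP[/forallPn[i0]]; rewrite -ltnNge => lt_i0 _.
pose t := wcols mo; pose T := tnth (in_tuple t).
have at_ : a \in t by rewrite (perm_mem (perm_wcols _)) mem_colseq.
have bt : b \in t by rewrite (perm_mem (perm_wcols _)) mem_colseq.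
have ab : a != b by apply: contraTneq lt_i0 => ->; rewrite ltnn.
pose ca : 'I_(size t) := Ordinal (etrans (index_mem a t) at_).
pose cb : 'I_(size t) := Ordinal (etrans (index_mem b t) bt).
have Ta : T ca = a by rewrite /T (tnth_nth a) nth_index.
have Tb : T cb = b by rewrite /T (tnth_nth a) nth_index.
have wT (c c' : 'I_(size t)) : (c <= c')%N -> (w (T c) <= w (T c'))%N.
  by move=> cc; rewrite /T !(tnth_nth a); apply: wcols_mono.
have cab : (ca <= cb)%N.
  rewrite leqNgt; apply/negP => /ltnW /wT; rewrite Ta Tb => wba.
  by case/eqP: ab; apply: hw.1; apply/eqP; rewrite eqn_leq wab.
(* Rows up to [i0] are taken in [b], then rows from [i0] on in [a]. Row [i0] is used twice, whence
   [j.-1] and [k.+1] entries, whose columns are dependent in any matrix with [k] rows. *)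
have rowlt (j : 'I_k.+1) : ((if (j <= i0)%N then j : nat else j.-1) < k)%N.
  by have := ltn_ord i0; have := ltn_ord j; case: ifP; lia.
pose pos (j : 'I_k.+1) : 'I_(size t) * 'I_k :=
  (if (j <= i0)%N then cb else ca, Ordinal (rowlt j)).
have E_mono (j j' : 'I_k.+1) : (j < j')%N ->
    (ento (T (pos j).1) (pos j).2 < ento (T (pos j').1) (pos j').2)%N.
  move=> jj; have j'k := ltn_ord j'; rewrite /=.
  have [j'i|ij'] := leqP j' i0.
    by rewrite (leq_trans (ltnW jj) j'i) ent_mono ?(leq_ltn_trans j'i).
  have [ji|ij] := leqP j i0; last by rewrite ent_mono //; lia.
  rewrite Ta Tb; apply: leq_ltn_trans (ent_leq _ ji (ltn_ord i0)) _.
  by apply: leq_trans lt_i0 _; apply: ent_leq; lia.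
have c_mono (j j' : 'I_k.+1) : (j < j')%N -> ((pos j').1 <= (pos j).1)%N.
  move=> jj /=; have [j'i|ij'] := leqP j' i0; first by rewrite (leq_trans (ltnW jj) j'i).
  by case: ifP.
exists (altpoly F T pos); split; last first.
  by rewrite -[mo](mcols_colseq (perm_wcols mo)); apply: altpoly_lead.
by move=> M _; apply: altpoly_eval => //; rewrite ltnS rank_leq_row.
Qed.

End LeadMonomials.

(** * Polynomials vanishing at all points in characteristic 0 *)

Section Vanishing.
Variable F : fieldType.
Hypothesis charF0 : [pchar F] =i pred0.

Lemma poly_vanish (p : {poly F}) : (forall x, p.[x] = 0) -> p = 0.
Proof.
move=> p0; apply: (@roots_geq_poly_eq0 _ p [seq i%:R | i <- iota 0 (size p)]).
- by apply/allP => x _; rewrite /root p0.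
- rewrite map_inj_uniq ?iota_uniq // => i j.
  wlog ij : i j / (i <= j)%N => [H|].
    by case: (leqP i j) => [|/ltnW] /H h // /esym/h.
  move/eqP; rewrite eq_sym -subr_eq0 -natrB // ((pcharf0P F).1 charF0) => e.
  by apply/eqP; rewrite eqn_leq ij -subn_eq0 e.
- by rewrite size_map size_iota.
Qed.

Lemma digits_inj B N (f g : 'I_N -> nat) :
  (forall i, f i < B)%N -> (forall i, g i < B)%N ->
  (\sum_(i < N) f i * B ^ i = \sum_(i < N) g i * B ^ i)%N -> f =1 g.
Proof.
elim: N f g => [|N IH] f g fB gB; first by move=> _ [].
have shift (h : 'I_N.+1 -> nat) : (\sum_(i < N.+1) h i * B ^ i =
    (\sum_(i < N) h (lift ord0 i) * B ^ i) * B + h ord0)%N.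
  rewrite big_ord_recl /= expn0 muln1 addnC; congr (_ + _)%N.
  by rewrite big_distrl; apply: eq_bigr => i _; rewrite /= expnSr mulnA.
rewrite !shift => e.
have e0 : f ord0 = g ord0.
  by have := congr1 (modn^~ B) e; rewrite /= !modnMDl !modn_small.
move: e; rewrite e0 => /addIn /eqP; rewrite eqn_pmul2r; last first.
  exact: leq_ltn_trans (fB ord0).
move/eqP/IH => h i; case: (unliftP ord0 i) => [j|] -> //.
exact: (h (fun=> fB _) (fun=> gB _)).
Qed.

(* Kronecker substitution reduces to one variable. *)
Lemma mpoly_vanish N (p : {mpoly F[N]}) : (forall v, p.@[v] = 0) -> p = 0.
Proof.
(* [B] exceeds every exponent in the support, so the base-[B] encoding [K] is injective there. *)
move=> p0; pose B := msize p.
pose K (u : 'X_{1..N}) := (\sum_(i < N) u i * B ^ i)%N.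
pose q : {poly F} := \sum_(u <- msupp p) p@_u *: 'X^(K u).
have q0 : q = 0.
  apply: poly_vanish => x; rewrite -[RHS](p0 (fun i => x ^+ (B ^ i))) mevalE horner_sum.
  apply: eq_bigr => u _; rewrite hornerZ hornerXn; congr (_ * _).
  by rewrite /K -prodrXr; apply: eq_bigr => i _; rewrite -exprM mulnC.
have uB u i : u \in msupp p -> (u i < B)%N.
  move/msize_mdeg_lt; apply: leq_ltn_trans.
  by rewrite mdegE (bigD1 i) //= leq_addr.
apply/mpolyP => u; rewrite mcoeff0.
have [us|/memN_msupp_eq0 //] := boolP (u \in msupp p).
have := congr1 (fun h : {poly F} => h`_(K u)) q0; rewrite coef0 coef_sum.
rewrite (bigD1_seq u) ?msupp_uniq //= coefZ coefXn eqxx mulr1 big_seq_cond.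
rewrite big1 ?addr0 // => u' /andP[u's u'u]; rewrite coefZ coefXn.
case: eqP => [/digits_inj e|]; last by rewrite mulr0.
by case/eqP: u'u; apply/mnmP => i; apply/esym/e => j; apply: uB.
Qed.

End Vanishing.

(** * Chains of cells, and levels labelling the cells by antichains *)

Section Levels.
Variables (n k d alpha m r : nat) (T : 'I_d -> ksub n k).
Hypothesis Tmono : forall c c' : 'I_d, (c <= c')%N -> pl_le (T c) (T c').
Local Notation cell := ('I_d * 'I_k)%type.

Definition inS (j : 'I_n) := (alpha <= j < alpha + m)%N.

Definition ccol (x : cell) : 'I_n := ento (T x.1) x.2.

(** A chain of [l.+1] cells with entries in S ends at [x], strictly increasing in row and in entry;
    the tableau columns of its cells are unrestricted. *)
Fixpoint reach (l : nat) (x : cell) : bool :=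
  inS (ccol x) && (if l is l'.+1 then
    [exists y : cell, [&& (y.2 < x.2)%N, (ccol y < ccol x)%N & reach l' y]] else true).

Lemma ccol_row (c : 'I_d) (i j : 'I_k) : (i < j)%N -> (ccol (c, i) < ccol (c, j))%N.
Proof. by rewrite /ccol /= => ?; rewrite ent_mono. Qed.

Lemma ccol_col (c c' : 'I_d) (i : 'I_k) : (c <= c')%N -> (ccol (c, i) <= ccol (c', i))%N.
Proof. by move=> /Tmono/pl_leP/(_ i). Qed.

(* A chain with arbitrary columns is straightened into a generalized antidiagonal
   by moving each cell to the right, up to the rightmost later column: the entry
   met there lies between the old one and the next one. *)
Lemma reach_chain l x : reach l x -> exists z : nat -> cell,
  [/\ z l = x, forall j, (j <= l)%N -> inS (ccol (z j)) /\ ((z j).2 <= x.2)%N &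
   forall j, (j < l)%N -> [/\ (z j.+1).1 <= (z j).1, (z j).2 < (z j.+1).2 &
                           ccol (z j) < ccol (z j.+1)]%N].
Proof.
elim: l x => [|l IH] x /=.
  by rewrite andbT => xS; exists (fun=> x); split=> // j; rewrite leqn0 => /eqP ->.
case/andP => xS /existsP[y /and3P[y2 yc /IH[z [zl zS zm]]]].
(* The maximum of [c] and the column of the new last cell [x]. *)
pose mx (c : 'I_d) : 'I_d := if (x.1 <= c)%N then c else x.1.
have mxge (c : 'I_d) : (x.1 <= mx c)%N by rewrite /mx; case: ifP.
have gemx (c : 'I_d) : (c <= mx c)%N by rewrite /mx; case: (leqP x.1 c) => // /ltnW.
have mxx (c : 'I_d) : (c < x.1)%N -> mx c = x.1 by rewrite /mx ltnNge; case: ifP.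
pose z' j := if (j <= l)%N then (mx (z j).1, (z j).2) else x.
have z'l : z' l.+1 = x by rewrite /z' ltnn.
have z'E j : (j <= l)%N -> z' j = (mx (z j).1, (z j).2) by rewrite /z' => ->.
exists z'; split=> // j.
  rewrite leq_eqVlt => /orP[/eqP ->|]; first by rewrite z'l.
  rewrite ltnS => jl; rewrite z'E //; have [zjS zjy] := zS j jl.
  have jx : ((z j).2 < x.2)%N := leq_ltn_trans zjy y2.
  split; last exact: ltnW.
  have lb : (ccol (z j) <= ccol (mx (z j).1, (z j).2))%N := ccol_col _ (gemx _).
  case/andP: zjS => zj1 zj2; rewrite /inS (leq_trans zj1 lb) andTb /mx.
  case: ifP => _; first exact: zj2.
  (* A cell that was moved now lies above [x] in the same column, so its entry stays below the upper
     end of S. *)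
  apply: leq_trans (ccol_row _ jx) _.
  by case/andP: xS => _ /ltnW.
rewrite ltnS leq_eqVlt => /orP[/eqP ->|jl].
  rewrite z'l z'E // zl; split=> //; rewrite /mx; case: (leqP x.1 y.1) => _ //.
  exact: ccol_row.
rewrite !z'E ?(ltnW jl) //; have [z1 z2 zc] := zm j jl.
have lt : (ccol (mx (z j).1, (z j).2) < ccol (mx (z j.+1).1, (z j.+1).2))%N.
  have [h|h] := leqP x.1 (z j).1.
    rewrite {1}/mx h; apply: leq_trans zc _; exact: ccol_col (gemx _).
  by rewrite !mxx ?(leq_ltn_trans z1 h) //; apply: ccol_row.
split=> //; rewrite /fst {1}/mx; case: (leqP x.1 (z j.+1).1) => h; last exact: mxge.
exact: leq_trans z1 (gemx _).
Qed.

(** The label of a cell in S is the last [l] before [reach] first fails; a cell further south-east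
    with the same label could be reached one step later. Outside S the label is the entry itself, so
    equal labels exclude a strict increase. *)
Lemma level_exists : (forall x, ~~ reach r x) ->
  exists lam : cell -> 'I_r + 'I_n,
  (forall x, match lam x with inl _ => inS (ccol x)
             | inr j => (j == ccol x) && ~~ inS (ccol x) end) /\
  (forall x y, lam x = lam y -> (x.2 < y.2)%N -> (ccol x < ccol y)%N -> False).
Proof.
move=> nr.
have h x : exists l : 'I_r + 'I_n, match l with
    | inl i => inS (ccol x) && reach i x && ~~ reach i.+1 x
    | inr j => (j == ccol x) && ~~ inS (ccol x) end.
  have [xS|xS] := boolP (inS (ccol x)); last by exists (inr (ccol x)); rewrite eqxx.
  have ex : exists l, ~~ reach l x by exists r.
  case: (ex_minnP ex) => [[|l]]; first by rewrite /= xS.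
  move=> nl lmin; have lr : (l < r)%N by apply: lmin.
  exists (inl (Ordinal lr)) => /=; move: nl => /= ->; rewrite andbT.
  by apply/negbNE/negP => /lmin; rewrite ltnn.
have [lam lamE] := fin_all_exists h; exists lam; split=> [x|x y].
  by have := lamE x; case: (lam x) => // i /andP[/andP[]].
move=> e xy2 xyc; have := lamE x; have := lamE y; rewrite e; case: (lam y) => [i|j].
  move=> /andP[/andP[yS _]] /negP nry /andP[/andP[_ rx] _]; apply: nry => /=.
  by rewrite yS; apply/existsP; exists x; rewrite xy2 xyc.
by move=> /andP[/eqP e1 _] /andP[/eqP e2 _]; move: xyc; rewrite -e1 -e2 ltnn.
Qed.

End Levels.

Lemma reach_gad n k alpha m r (t : seq (ksub n k)) x :
  (forall c c' : 'I_(size t), (c <= c')%N ->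
     pl_le (tnth (in_tuple t) c) (tnth (in_tuple t) c')) ->
  reach alpha m (tnth (in_tuple t)) r x -> has_gad alpha m r.+1 t.
Proof.
move=> Tm /(reach_chain Tm)[z [_ zS zm]].
exists (fun j => (z (r - j)%N).1 : nat), (fun j => (z j).2 : nat) => /=.
pose T := tnth (in_tuple t).
have eE j : (j <= r)%N -> nth 0%N (nth [::] [seq elems i | i <- t] (z (r - (r - j))%N).1) (z j).2
    = ccol T (z j) :> nat.
  move=> jr; rewrite subKn //; have a0 := T (z j).1.
  by rewrite (nth_map a0) //= /ccol /= /ent /T (tnth_nth a0).
split; first by move=> j _; rewrite !ltn_ord.
split=> [j jr|].
  have [_ h2 _] := zm j jr; split=> //.
  have hj : (r - j.+1 < r)%N by lia.
  by have [h1 _ _] := zm _ hj; rewrite -subSn // subSS in h1.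
split=> j jr; first by rewrite eE //; apply: (zS j jr).1.
by rewrite !eE //; [have [] := zm j jr | exact: ltnW].
Qed.

(** * Quadrant counts of tableaux and their extremal properties *)

Section Counting.
Local Open Scope nat_scope.

Lemma leq_sum_eq (I : finType) (f g : I -> nat) :
  (forall i, f i <= g i) -> \sum_i g i <= \sum_i f i -> forall i, f i = g i.
Proof.
move=> fg gf i; apply/eqP; rewrite eqn_leq fg leqNgt; apply/negP => lt.
move: gf; apply/negP; rewrite -ltnNge (bigD1 i) //= [ltnRHS](bigD1 i) //=.
by rewrite -addSn leq_add // leq_sum.
Qed.

Lemma perm_geq_id k (s : 'S_k) : (forall i : 'I_k, i <= s i) -> s = 1%g.
Proof.
move=> h; apply/permP => i; rewrite perm1; apply/val_inj/esym.
apply: (leq_sum_eq (f := fun i => val i) (g := fun i => val (s i))) => //.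
by rewrite [leqRHS](reindex_inj (@perm_inj _ s)).
Qed.

Lemma sum_incl_excl (I : finType) (P A B : pred I) :
  \sum_(x | P x) (A x && B x) + \sum_(x | P x) 1 =
  \sum_(x | P x) A x + \sum_(x | P x) B x + \sum_(x | P x) (~~ A x && ~~ B x).
Proof.
by rewrite -!big_split; apply: eq_bigr => x _; case: (A x); case: (B x).
Qed.

(* By inclusion-exclusion, the counts of the closed south-east quadrant and of the
   opposite open north-west one differ by a constant depending on the margins only,
   and for an antichain one of them is 0. *)
Lemma quadrant_min (L X Y : finType) (lx : X -> L) (ly : Y -> L)
    (rx cx : X -> nat) (ry cy : Y -> nat) :
  (forall l p, \sum_(x | lx x == l) (p <= rx x) = \sum_(y | ly y == l) (p <= ry y)) ->
  (forall l q, \sum_(x | lx x == l) (q <= cx x) = \sum_(y | ly y == l) (q <= cy y)) ->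
  (forall x x', lx x = lx x' -> rx x < rx x' -> cx x < cx x' -> False) ->
  forall p q, \sum_x ((p <= rx x) && (q <= cx x)) <= \sum_y ((p <= ry y) && (q <= cy y)).
Proof.
move=> hr hc anti p q.
rewrite (partition_big lx xpredT) //= [leqRHS](partition_big ly xpredT) //=.
apply: leq_sum => l _.
have := sum_incl_excl (fun x => lx x == l) (fun x => p <= rx x) (fun x => q <= cx x).
have := sum_incl_excl (fun y => ly y == l) (fun y => p <= ry y) (fun y => q <= cy y).
have := hr l p; have := hc l q; have := hr l 0 => /=.
(* A cell [x] in the closed south-east quadrant empties the open north-west one: a cell there with
   label [l] would form a forbidden pair with [x]. *)
case: (posnP (\sum_(x | lx x == l) ((p <= rx x) && (q <= cx x)))) => [-> //|].
rewrite lt0n sum_nat_eq0 => /forallPn[x]; rewrite negb_imply eqb0 negbK => /andP[/eqP lxl /andP[px qx]].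
rewrite [X in _ -> _ -> _ -> _ -> _ = _ + X -> _]big1 => [|x' /eqP lx'l]; first lia.
rewrite -!ltnNge; case: ltnP => //= px'; case: ltnP => //= qx'.
case: (anti x' x); first by rewrite lxl.
  exact: leq_trans px' px.
exact: leq_trans qx' qx.
Qed.

Variables (n k : nat).

(** If all rows from [p] on have diagonal entry at least [q], the right side counts all these rows;
    otherwise all entries that are at least [q] lie in these rows, and it counts all such entries.
    Either number bounds the left side. *)
Lemma quadrant_perm (a : ksub n k) (s : 'S_k) p q :
  \sum_(i < k) ((p <= i) && (q <= ento a (s i))) <=
  \sum_(i < k) ((p <= i) && (q <= ento a i)).
Proof.
have [/forallP h|/forallPn[i0]] := boolP [forall i : 'I_k, (p <= i) ==> (q <= ento a i)].
  apply: leq_sum => i _; have := h i; case: (p <= i) => //= ->.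
  by case: (q <= _).
rewrite negb_imply -ltnNge => /andP[pi0 qi0].
rewrite [leqRHS](eq_bigr (fun i => nat_of_bool (q <= ento a i))) => [|i _].
  rewrite [leqRHS](reindex_inj (@perm_inj _ s)) /=; apply: leq_sum => i _.
  by case: (p <= i).
case: (leqP q (ento a i)) => qi; rewrite ?andbF // andbT.
suff -> : p <= i by [].
by apply: leq_trans pi0 _; rewrite -(ento_leq a) (ltnW (leq_trans qi0 qi)).
Qed.

(** With [q = ento a p] the diagonal count includes every row from [p] on, so equality forces
    [p <= s p]. *)
Lemma quadrant_perm_eq (a : ksub n k) (s : 'S_k) :
  (forall (p : 'I_k) (q : 'I_n), \sum_(i < k) ((p <= i) && (q <= ento a (s i))) =
  \sum_(i < k) ((p <= i) && (q <= ento a i))) -> s = 1%g.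
Proof.
move=> h; apply: perm_geq_id => p; have := h p (ento a p).
rewrite [RHS](eq_bigr (fun i : 'I_k => nat_of_bool (p <= i))) => [e|i _]; last first.
  by rewrite ento_leq andbb.
have := @leq_sum_eq _ (fun i : 'I_k => nat_of_bool ((p <= i) && (ento a p <= ento a (s i))))
  (fun i : 'I_k => nat_of_bool (p <= i)) _ _ p.
rewrite leqnn ento_leq andTb => H; have {H} : nat_of_bool (p <= s p) = 1.
  by apply: H; [move=> i; case: (p <= i); rewrite ?leq_b1 | rewrite e].
by case: (p <= s p).
Qed.

Definition quad d (T : 'I_d -> ksub n k) (p q : nat) :=
  \sum_(x : 'I_d * 'I_k) ((p <= x.2) && (q <= ccol T x)).

(** Each row is weakly increasing, hence determined by how many of its entries reach each
    threshold. *)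
Lemma quad_inj d (T T' : 'I_d -> ksub n k) :
  (forall c c' : 'I_d, c <= c' -> pl_le (T c) (T c')) ->
  (forall c c' : 'I_d, c <= c' -> pl_le (T' c) (T' c')) ->
  (forall i q, \sum_(c < d) (q <= ento (T c) i) = \sum_(c < d) (q <= ento (T' c) i)) ->
  T =1 T'.
Proof.
move=> Tm Tm' h c; apply: ento_ext => i; apply: val_inj => /=.
wlog lt : T T' Tm Tm' h / ent (T c) i < ent (T' c) i => [H|].
  case: (ltngtP (ent (T c) i) (ent (T' c) i)) => // lt; first exact: H.
  by apply/esym; apply: H.
have := h i (ent (T' c) i); move/eqP; rewrite eqn_leq => /andP[_].
rewrite leqNgt => /negP[]; rewrite (bigD1 c) //= [ltnRHS](bigD1 c) //= leqnn.
have /negPf -> : ~~ (ent (T' c) i <= ent (T c) i) by rewrite -ltnNge.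
rewrite add0n add1n ltnS; apply: leq_sum => c' c'c.
case: (leqP (ent (T' c) i) (ent (T c') i)) => // q1; suff -> : ent (T' c) i <= ent (T' c') i by [].
apply: (pl_leP _ _ (Tm' c c' _)); rewrite leqNgt; apply/negP => /ltnW /Tm /pl_leP /(_ i) /= h'.
by move: lt; rewrite ltnNge (leq_trans q1 h').
Qed.

Lemma quad_rows d (T : 'I_d -> ksub n k) (i : 'I_k) q :
  quad T i q = \sum_(c < d) (q <= ento (T c) i) + quad T i.+1 q.
Proof.
rewrite /quad -!(pair_bigA _ (fun c (x : 'I_k) => nat_of_bool ((_ <= x) && (q <= ccol T (c, x))))) /=.
rewrite -big_split; apply: eq_bigr => c _ /=.
rewrite (bigD1 i) //= leqnn [X in _ = _ + X](bigD1 i) //= ltnn add0n; congr (_ + _).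
by apply: eq_bigr => j ji; rewrite [i < j]ltn_neqAle eq_sym (inj_eq val_inj) ji.
Qed.

Lemma quad_out d (T : 'I_d -> ksub n k) p q : (k <= p) || (n <= q) -> quad T p q = 0.
Proof.
move=> h; apply: big1 => x _; case: leqP => //= px; case: leqP => // qx.
by have := ltn_ord x.2; have := ltn_ord (ccol T x); rewrite /= in qx *; lia.
Qed.

Lemma quad_mcols d d' (T : 'I_d -> ksub n k) (T' : 'I_d' -> ksub n k) : 0 < k ->
  (forall c c' : 'I_d, c <= c' -> pl_le (T c) (T c')) ->
  (forall c c' : 'I_d', c <= c' -> pl_le (T' c) (T' c')) ->
  (forall (p : 'I_k) (q : 'I_n), quad T p q = quad T' p q) -> mcols T = mcols T'.
Proof.
move=> k0 Tm Tm' h.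
have h' p q : quad T p q = quad T' p q.
  have [pk|pk] := ltnP p k; last by rewrite !quad_out // pk.
  have [qn|qn] := ltnP q n; last by rewrite !quad_out // qn orbT.
  exact: (h (Ordinal pk) (Ordinal qn)).
have hrow i q : \sum_(c < d) (q <= ento (T c) i) = \sum_(c < d') (q <= ento (T' c) i).
  by apply: (@addIn (quad T i.+1 q)); rewrite -quad_rows [in RHS]h' -quad_rows h'.
(* Every entry of row 0 reaches threshold 0, so this count is the number of columns. *)
have e : d = d'.
  by have := hrow (Ordinal k0) 0; rewrite !sum1_card !card_ord.
move: T' Tm' h h' hrow; rewrite -e => T' Tm' _ _ hrow.
by apply: eq_bigr => c _; rewrite (quad_inj Tm Tm' hrow).
Qed.

End Counting.

(** * A parametrized family of matrices satisfying the rank condition *)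

Section Parametrization.
Variables (F : fieldType) (n k alpha m r : nat).
Hypothesis han : (alpha + m <= n)%N.

(* The columns in S are spanned by r vectors, labelled by ['I_r]; a column j
   outside S is spanned by its own vector, labelled by [inr j]. *)
Local Notation lab := ('I_r + 'I_n)%type.
Local Notation par := (('I_k * lab) + (lab * 'I_n))%type.
Definition npar : nat := #|{: par}|.
Local Notation N := npar.
Definition pvl (i : 'I_k) (l : lab) : 'I_N := enum_rank (inl (i, l)).
Definition pvr (l : lab) (j : 'I_n) : 'I_N := enum_rank (inr (l, j)).

Definition okl (j : 'I_n) (l : lab) : bool :=
  match l with inl _ => inS alpha m j | inr j' => (j' == j) && ~~ inS alpha m j end.

Definition pmon (i : 'I_k) (l : lab) (j : 'I_n) : 'X_{1..N} := (U_(pvl i l) + U_(pvr l j))%MM.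

Definition pmx : 'M[{mpoly F[N]}]_(k, n) :=
  \matrix_(i, j) \sum_(l | okl j l) 'X_[pmon i l j].

Definition pmxv (v : 'I_N -> F) : 'M[F]_(k, n) := map_mx (meval v) pmx.

(** Columns in S use only the [r] labels [inl], so this submatrix factors through dimension [r]. *)
Lemma rank_pmxv v : (\rank (colS alpha m (pmxv v)) <= r)%N.
Proof.
have jn (j : 'I_m) : (alpha + j < n)%N by apply: leq_trans han; rewrite ltn_add2l.
pose A : 'M[F]_(k, r) := \matrix_(i, l) v (pvl i (inl l)).
pose B : 'M[F]_(r, m) := \matrix_(l, j) v (pvr (inl l) (Ordinal (jn j))).
suff -> : colS alpha m (pmxv v) = A *m B.
  exact: leq_trans (mxrankM_maxl _ _) (rank_leq_col _).
apply/matrixP => i j; rewrite (@colSE _ _ _ _ _ _ _ _ (Ordinal (jn j))) // !mxE.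
have jS : inS alpha m (Ordinal (jn j)) by rewrite /inS /= leq_addr ltn_add2l ltn_ord.
rewrite raddf_sum /= big_sumType /= [X in _ + X]big_pred0 ?addr0 => [|l]; last first.
  by rewrite jS andbF.
rewrite (eq_bigl xpredT) //; apply: eq_bigr => l _.
by rewrite mpolyXD mevalM !mevalXU !mxE.
Qed.

Variables (d : nat) (T : 'I_d -> ksub n k).
Local Notation cell := ('I_d * 'I_k)%type.

Definition pcolh (h : {ffun 'I_d -> 'S_k}) (x : cell) : 'I_n := ento (T x.1) (h x.1 x.2).

(** The term of a product of minors of [pmx] selected by one Leibniz permutation per column and one
    label per cell. *)
Definition cmon h (lam : cell -> lab) : 'X_{1..N} :=
  (\sum_x pmon x.2 (lam x) (pcolh h x))%MM.

Lemma prod_cminor_pmx : \prod_c cminor pmx (ento (T c)) =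
  \sum_h \sum_(lam in family (fun x => okl (pcolh h x)))
    (\prod_c (-1) ^+ h c) *: 'X_[cmon h (lam : {ffun cell -> lab})].
Proof.
rewrite /cminor /determinant bigA_distr_bigA /=; apply: eq_bigr => h _.
rewrite big_split /= -scaler_sumr -mul_mpolyC rmorph_prod /=.
congr (_ * _); first by apply: eq_bigr => c _; rewrite rmorphXn rmorphN rmorph1.
rewrite pair_bigA /=.
under eq_bigr => x _ do rewrite !mxE -/(pcolh h x).
by rewrite bigA_distr_big_dep; apply: eq_bigr => lam _; rewrite /cmon mpolyX_sum.
Qed.

Lemma pvl_inj i i' l l' : (pvl i l == pvl i' l') = (i == i') && (l == l').
Proof. by rewrite (inj_eq enum_rank_inj). Qed.

Lemma pvr_inj j j' l l' : (pvr l j == pvr l' j') = (l == l') && (j == j').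
Proof. by rewrite (inj_eq enum_rank_inj). Qed.

Lemma pvlr i l l' j : (pvl i l == pvr l' j) = false.
Proof. by rewrite (inj_eq enum_rank_inj). Qed.

Lemma pvrl i l l' j : (pvr l' j == pvl i l) = false.
Proof. by rewrite (inj_eq enum_rank_inj). Qed.

Lemma cmonE h lam v : cmon h lam v = (\sum_x pmon x.2 (lam x) (pcolh h x) v)%N.
Proof. exact: mnm_sumE. Qed.

(** Together with [cmon_col]: the monomial determines the row and column margins of each label, as
    [quadrant_min] requires. *)
Lemma cmon_row h lam l p :
  (\sum_(i < k | p <= i) cmon h lam (pvl i l) = \sum_(x | lam x == l) (p <= x.2))%N.
Proof.
under [LHS]eq_bigr => i _ do rewrite cmonE.
rewrite exchange_big /= [RHS]big_mkcond /=; apply: eq_bigr => x _.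
under [LHS]eq_bigr => i _ do rewrite /pmon mnmDE !mnm1E pvrl pvl_inj addn0.
rewrite big_mkcond (bigD1 x.2) //= eqxx big1 ?addn0 => [|i /negPf ix]; last first.
  by rewrite eq_sym ix; case: ifP.
by case: (lam x == l); case: (p <= x.2)%N.
Qed.

Lemma cmon_col h lam l q :
  (\sum_(j < n | q <= j) cmon h lam (pvr l j) = \sum_(x | lam x == l) (q <= pcolh h x))%N.
Proof.
under [LHS]eq_bigr => i _ do rewrite cmonE.
rewrite exchange_big /= [RHS]big_mkcond /=; apply: eq_bigr => x _.
under [LHS]eq_bigr => i _ do rewrite /pmon mnmDE !mnm1E pvlr pvr_inj add0n.
rewrite big_mkcond (bigD1 (pcolh h x)) //= eqxx big1 ?addn0 => [|i /negPf ix]; last first.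
  by rewrite [_ == i]eq_sym ix andbF; case: ifP.
by rewrite andbT; case: (lam x == l); case: ifP.
Qed.

End Parametrization.

(** * Linear independence of the surviving monomials *)

Definition qweight n k d (T : 'I_d -> ksub n k) :=
  (\sum_(pq : 'I_k * 'I_n) quad T pq.1 pq.2)%N.

(** Quadrant by quadrant, [quad T <= mid <= quad T']: first by minimality of antichains, then by
    maximality of the diagonal term. The weight bound turns both into equalities, which identify the
    monomials and force [h'] to be trivial. *)
Lemma cmon_unique n k r d d' (T : 'I_d -> ksub n k) (T' : 'I_d' -> ksub n k)
    (lam : 'I_d * 'I_k -> 'I_r + 'I_n) lam' h' : (0 < k)%N ->
  (forall c c' : 'I_d, (c <= c')%N -> pl_le (T c) (T c')) ->
  (forall c c' : 'I_d', (c <= c')%N -> pl_le (T' c) (T' c')) ->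
  (forall x y, lam x = lam y -> (x.2 < y.2)%N -> (ccol T x < ccol T y)%N -> False) ->
  cmon T' h' lam' = cmon T [ffun=> 1%g] lam -> (qweight T' <= qweight T)%N ->
  mcols T' = mcols T /\ h' = [ffun=> 1%g].
Proof.
move=> k0 Tm Tm' anti e wle.
have c1 x : pcolh T [ffun=> 1%g] x = ccol T x by rewrite /pcolh ffunE perm1.
pose mid p q := (\sum_(x : 'I_d' * 'I_k) ((p <= x.2) && (q <= pcolh T' h' x)))%N.
have le1 p q : (quad T p q <= mid p q)%N.
  apply: (quadrant_min (lx := lam) (ly := lam') (rx := fun x => val x.2)
    (cx := fun x => val (ccol T x)) (ry := fun x => val x.2)
    (cy := fun x => val (pcolh T' h' x))) => // l {}p /=.
    by rewrite -(cmon_row T [ffun=> 1%g]) -(cmon_row T' h') e.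
  rewrite -(cmon_col T' h') e (cmon_col T); apply: eq_bigr => x _.
  by rewrite c1.
have le2c p q (c : 'I_d') := quadrant_perm (T' c) (h' c) p q.
have midE p q : mid p q = (\sum_(c < d') \sum_(i < k) ((p <= i) && (q <= ento (T' c) (h' c i))))%N.
  by rewrite pair_bigA.
have quadE p q : quad T' p q = (\sum_(c < d') \sum_(i < k) ((p <= i) && (q <= ento (T' c) i)))%N.
  by rewrite pair_bigA.
have le2 p q : (mid p q <= quad T' p q)%N by rewrite midE quadE; apply: leq_sum.
have eq1 (p : 'I_k) (q : 'I_n) : quad T p q = quad T' p q.
  apply: (leq_sum_eq (f := fun pq : 'I_k * 'I_n => quad T pq.1 pq.2)
     (g := fun pq : 'I_k * 'I_n => quad T' pq.1 pq.2) _ wle (p, q)) => pq.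
  exact: leq_trans (le1 _ _) (le2 _ _).
split; first by apply/esym; apply: (quad_mcols k0 Tm Tm').
apply/ffunP => c; rewrite ffunE; apply: (@quadrant_perm_eq n k (T' c)) => p q.
apply: (leq_sum_eq (fun c => le2c p q c)).
by rewrite -midE -quadE -eq1.
Qed.

Lemma seq_argmax (X : eqType) (W : X -> nat) (s : seq X) : s != [::] ->
  exists2 x, x \in s & forall y, y \in s -> (W y <= W x)%N.
Proof.
elim: s => // x s IH _; case: (eqVneq s [::]) => [->|/IH[y ys ymax]].
  by exists x; rewrite ?inE // => y; rewrite inE => /eqP ->.
have [xy|yx] := leqP (W x) (W y).
  by exists y; rewrite ?inE ?ys ?orbT // => z; rewrite inE => /orP[/eqP -> //|/ymax].
exists x; rewrite ?inE ?eqxx // => z; rewrite inE => /orP[/eqP -> //|/ymax h].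
exact: leq_trans h (ltnW yx).
Qed.

Section Independence.
Variables (F : fieldType) (n k alpha m r : nat) (w : ksub n k -> nat).
Hypotheses (charF0 : [pchar F] =i pred0) (hw : linext w) (k0 : (0 < k)%N).
Hypothesis han : (alpha + m <= n)%N.

Definition surviving (mo : 'X_{1..nvars n k}) := ~ cond1 mo /\ ~ cond2 alpha m r mo.

Local Notation Tw mo := (tnth (in_tuple (wcols w mo))).

Lemma wcols_pl_mono mo : ~ cond1 mo ->
  forall c c' : 'I_(size (wcols w mo)), (c <= c')%N -> pl_le (Tw mo c) (Tw mo c').
Proof.
move=> n1 c c' cc; have a0 := Tw mo c.
have wle : (w (Tw mo c) <= w (Tw mo c'))%N.
  by rewrite !(tnth_nth a0); apply: wcols_mono.
have pos x : (0 < mo (Pvar (Tw mo x)))%N.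
  by rewrite -mem_colseq -(perm_mem (perm_wcols w mo)) mem_tnth.
have : pl_comparable (Tw mo c) (Tw mo c').
  by apply/negP => /negP nc; apply: n1; exists (Tw mo c), (Tw mo c').
case/orP => // h; have /hw.1 -> : w (Tw mo c) = w (Tw mo c'); last exact: pl_le_refl.
by apply/eqP; rewrite eqn_leq wle hw.2.
Qed.

Lemma surviving_reach mo x : surviving mo -> ~~ reach alpha m (Tw mo) r x.
Proof.
case=> n1 n2; apply/negP => /(reach_gad (wcols_pl_mono n1)) gad; apply: n2.
split.
  move=> a b ma mb; apply/negP => /negP nab; apply: n1; by exists a, b.
exists (wcols w mo); split; first exact: perm_wcols.
split=> //; have a0 := Tw mo x.1; apply/(sortedP a0) => i ilt.
have := wcols_pl_mono n1 (c := Ordinal (ltnW ilt)) (c' := Ordinal ilt) (leqnSn i).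
by rewrite !(tnth_nth a0).
Qed.

Lemma mevalX_cols (M : 'M[F]_(k, n)) d (T : 'I_d -> ksub n k) :
  ('X_[mcols T]).@[pluckv M] = \prod_c cminor M (ento (T c)).
Proof.
rewrite mpolyX_sum rmorph_prod; apply: eq_bigr => c _ /=.
by rewrite mevalXU /pluckv /Pvar enum_rankK pluckE.
Qed.

Lemma surviving_indep (f : {mpoly F[nvars n k]}) : Jideal alpha m r f ->
  (forall mo, mo \in msupp f -> surviving mo) -> f = 0.
Proof.
move=> fJ fS; apply/eqP; rewrite -msupp_eq0; apply/negPn/negP => f0.
have [mo0 mo0f mo0max] := seq_argmax (fun mo => qweight (Tw mo)) f0.
pose T0 := Tw mo0; have S0 := fS _ mo0f.
have [lam0 [ok0 anti0]] := level_exists (fun x => surviving_reach x S0).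
pose lam : {ffun 'I_(size (wcols w mo0)) * 'I_k -> 'I_r + 'I_n} := [ffun x => lam0 x].
have anti x y : lam x = lam y -> (x.2 < y.2)%N -> (ccol T0 x < ccol T0 y)%N -> False.
  by rewrite !ffunE; apply: anti0.
pose one d := [ffun=> 1%g] : {ffun 'I_d -> 'S_k}.
pose phi := cmon T0 (one _) lam.
pose G mo := \prod_c cminor (pmx F n k alpha m r) (ento (Tw mo c)).
have G0 : \sum_(mo <- msupp f) f@_mo *: G mo = 0.
  apply: (mpoly_vanish charF0) => v; rewrite -[RHS](fJ _ (rank_pmxv han v)).
  rewrite [in RHS](mpolyE f) !raddf_sum /=; apply: eq_bigr => mo _; rewrite !mevalZ.
  congr (_ * _); rewrite -{2}(mcols_colseq (perm_wcols w mo)) mevalX_cols rmorph_prod /=.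
  apply: eq_bigr => c _; rewrite /cminor -det_map_mx; congr (\det _).
  by apply/matrixP => i j; rewrite !mxE.
have uniq mo h (lam' : {ffun 'I_(size (wcols w mo)) * 'I_k -> 'I_r + 'I_n}) :
    mo \in msupp f -> cmon (Tw mo) h lam' = phi -> mo = mo0 /\ h = one _.
  move=> mof e; have Sm := fS _ mof.
  have [e1 ->] := cmon_unique k0 (wcols_pl_mono S0.1) (wcols_pl_mono Sm.1) anti e (mo0max _ mof).
  split=> //; move: e1.
  by rewrite (mcols_colseq (perm_wcols w mo)) (mcols_colseq (perm_wcols w mo0)).
have := congr1 (mcoeff phi) G0; rewrite raddf_sum mcoeff0 /= (bigD1_seq mo0) ?msupp_uniq //=.
rewrite big_seq_cond big1 ?addr0 => [|mo /andP[mof ne]]; last first.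
  rewrite mcoeffZ /G prod_cminor_pmx raddf_sum big1 ?mulr0 // => h _.
  rewrite raddf_sum big1 // => lam' _; rewrite /= mcoeffZ mcoeffX.
  case: eqP => [/(uniq _ _ _ mof)[e _]|]; last by rewrite mulr0.
  by rewrite e eqxx in ne.
rewrite mcoeffZ => /eqP; rewrite mulf_eq0 mcoeff_eq0 mo0f /=.
rewrite /G prod_cminor_pmx raddf_sum (bigD1 (one _)) //= [X in _ + X]big1 ?addr0 => [|h hne]; last first.
  rewrite raddf_sum big1 // => lam' _; rewrite /= mcoeffZ mcoeffX.
  case: eqP => [/(uniq _ _ _ mo0f)[_ e]|]; last by rewrite mulr0.
  by rewrite e eqxx in hne.
(* Only trivial permutations remain, with sign 1, so the coefficient counts the labellings with
   monomial [phi]. The labelling [lam] is one of them, so it is nonzero in characteristic 0. *)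
rewrite raddf_sum /= (eq_bigr (fun lam' : {ffun _ -> _} =>
    (nat_of_bool (cmon T0 (one _) lam' == phi))%:R)) => [|lam' _]; last first.
  by rewrite mcoeffZ mcoeffX big1 ?mul1r // => c _; rewrite ffunE odd_perm1.
rewrite -natr_sum ((pcharf0P F).1 charF0); apply/negP; rewrite -lt0n.
rewrite (bigD1 lam) /= ?eqxx //; apply/familyP => x; rewrite ffunE.
by have := ok0 x; rewrite /pcolh ffunE perm1 unfold_in /okl.
Qed.

End Independence.

(** * The degree reverse lexicographic order and its well-foundedness *)

Section DrlOrder.
Variables (n k : nat) (w : ksub n k -> nat).
Hypothesis hw : linext w.
Local Notation mon := 'X_{1..nvars n k}.

Lemma drl_irr (u : mon) : ~ drl_lt w u u.
Proof. by case=> [|[_ [a []]]]; rewrite ltnn. Qed.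

Lemma drl_trans (u v x : mon) : drl_lt w u v -> drl_lt w v x -> drl_lt w u x.
Proof.
case=> [d1|[d1 [a [la ea]]]] [d2|[d2 [b [lb eb]]]].
- by left; apply: ltn_trans d2.
- by left; rewrite -d2.
- by left; rewrite d1.
right; split; first by rewrite d1.
case: (ltngtP (w a) (w b)) => ab.
- exists a; rewrite -eb //; split=> // c ca; rewrite ea // eb //.
  exact: ltn_trans ab.
- exists b; rewrite ea //; split=> // c cb; rewrite ea ?eb //.
  exact: ltn_trans ab.
move/hw.1: ab => ab; exists a; split; first by apply: ltn_trans la; rewrite ab.
by move=> c ca; rewrite ea // eb // -ab.
Qed.

Lemma drl_mull (x u v : mon) : drl_lt w u v -> drl_lt w (x + u)%MM (x + v)%MM.
Proof.
case=> [d1|[d1 [a [la ea]]]]; [left|right]; rewrite !mdegD; first by rewrite ltn_add2l.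
rewrite d1; split=> //; exists a; split=> [|b /ea e]; first by rewrite !mnmDE ltn_add2l.
by rewrite !mnmDE e.
Qed.

Definition drl_ltb (u v : mon) : bool :=
  (mdeg u < mdeg v)%N || (mdeg u == mdeg v) &&
  [exists a, (v (Pvar a) < u (Pvar a))%N &&
     [forall b, (w b < w a)%N ==> (u (Pvar b) == v (Pvar b))]].

Lemma drl_ltP u v : reflect (drl_lt w u v) (drl_ltb u v).
Proof.
apply: (iffP orP) => -[h|]; try by left.
- case/andP=> /eqP e /existsP[a /andP[la /forallP ea]]; right; split=> //.
  by exists a; split=> // b ba; apply/eqP/(implyP (ea b)).
- case=> e [a [la ea]]; right; rewrite e eqxx; apply/existsP; exists a; rewrite la.
  by apply/forallP => b; apply/implyP => /ea ->.
Qed.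

(** Induction on the number of smaller monomials; it is finite because their degrees are bounded by
    that of [u]. *)
Lemma drl_ind (P : mon -> Prop) :
  (forall u, (forall v, drl_lt w v u -> P v) -> P u) -> forall u, P u.
Proof.
move=> IH u; have [D] : exists D, (mdeg u < D)%N by exists (mdeg u).+1.
pose mu x := #|[set v : bmultinom (nvars n k) D | drl_ltb v x]|.
have [N] := ubnP (mu u); elim: N u => // N IHN u; rewrite ltnS => muN uD.
apply: IH => v vu; have vD : (mdeg v < D)%N.
  by apply: leq_ltn_trans uD; case: vu => [/ltnW|[->]].
apply: IHN => //; apply: leq_trans muN; apply: proper_card; apply/properP; split.
  by apply/subsetP => x; rewrite !inE => /drl_ltP xv; apply/drl_ltP/(drl_trans xv).
by exists (BMultinom vD); rewrite !inE; apply/drl_ltP => //; apply: drl_irr.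
Qed.

End DrlOrder.

(** * Reduction to surviving monomials and the initial ideal *)

Section Reduction.
Variables (F : fieldType) (n k alpha m r : nat) (w : ksub n k -> nat).
Hypotheses (charF0 : [pchar F] =i pred0) (hw : linext w).
Local Notation mon := 'X_{1..nvars n k}.
Local Notation J := (Jideal (F := F) (n := n) (k := k) alpha m r).
Local Notation surv := (surviving alpha m r).

Lemma Jideal0 : J 0. Proof. by move=> M _; rewrite meval0. Qed.

Lemma JidealD f g : J f -> J g -> J (f + g).
Proof. by move=> Jf Jg M rk; rewrite mevalD Jf // Jg // addr0. Qed.

Lemma JidealZ c f : J f -> J (c *: f).
Proof. by move=> Jf M rk; rewrite mevalZ Jf // mulr0. Qed.

Lemma JidealM f g : J f -> J (f * g).
Proof. by move=> Jf M rk; rewrite mevalM Jf // mul0r. Qed.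

Lemma reduce_poly (Q : mon -> Prop) (h : {mpoly F[nvars n k]}) :
  (forall u, u \in msupp h ->
     exists g, J ('X_[u] - g) /\ forall v, v \in msupp g -> Q v) ->
  exists g, J (h - g) /\ forall v, v \in msupp g -> Q v.
Proof.
move=> hQ; rewrite [h]mpolyE; have: {subset msupp h <= msupp h} by [].
elim: {1 3}(msupp h) => [|u s IH] sub.
  by exists 0; rewrite big_nil subr0; split; [exact: Jideal0 | move=> v; rewrite msupp0].
have [v vs|g [Jg gQ]] := IH; first by apply: sub; rewrite inE vs orbT.
have [g' [Jg' gQ']] := hQ u (sub _ (mem_head _ _)).
exists (h@_u *: g' + g); split.
  rewrite big_cons opprD addrACA -scalerBr; apply: JidealD => //; exact: JidealZ.
move=> v /msuppD_le; rewrite mem_cat => /orP[/msuppZ_le /gQ' //|/gQ //].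
Qed.

Lemma cond_lead (mo : mon) : cond1 mo \/ cond2 alpha m r mo ->
  exists f : {mpoly F[nvars n k]}, J f /\ is_lead w f mo.
Proof. by case=> [|]; [exact: cond1_lead | exact: cond2_lead]. Qed.

Lemma not_surviving (mo : mon) : ~ surv mo -> cond1 mo \/ cond2 alpha m r mo.
Proof. by move=> /not_and_or[] /NNPP; [left | right]. Qed.

(** If [u] does not survive, it leads some element of [J]; subtracting a multiple of that element
    replaces [u] by smaller monomials, to which induction applies. *)
Lemma reduce_mon (u : mon) : exists g, J ('X_[u] - g) /\
  forall v, v \in msupp g -> surv v /\ (v = u \/ drl_lt w v u).
Proof.
elim/(drl_ind hw): u => u IH.
have [Su|/not_surviving/cond_lead[f [Jf [uf lf]]]] := classic (surv u).
  exists 'X_[u]; rewrite subrr; split; first exact: Jideal0.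
  by move=> v; rewrite msuppX inE => /eqP ->; split=> //; left.
have fu : f@_u != 0 by rewrite -mcoeff_msupp.
pose h := 'X_[u] - (f@_u)^-1 *: f.
have hlt v : v \in msupp h -> drl_lt w v u.
  move=> vh; apply: lf => [|e].
    move: vh => /[dup] /msuppB_le; rewrite mem_cat => /orP[|/msuppZ_le //].
    by rewrite msuppX inE => /eqP ->.
  by move: vh; rewrite e mcoeff_msupp mcoeffB mcoeffX mcoeffZ eqxx mulVf // subrr eqxx.
have [v /hlt vu|g [Jg gS]] := @reduce_poly (fun v => surv v /\ drl_lt w v u) h.
  have [g [Jg gS]] := IH v vu; exists g; split=> // x /gS[Sx xv]; split=> //.
  by case: xv => [-> //|xv]; exact: drl_trans hw _ _ _ xv vu.
exists g; split; last by move=> v /gS[Sv vu]; split=> //; right.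
rewrite -[X in X - g](subrK ((f@_u)^-1 *: f)) -/h addrAC; apply: JidealD => //; exact: JidealZ.
Qed.

(** If [mo] survived, reducing the other terms of [f] would give an element of [J] supported on
    surviving monomials, hence 0. But the reduced tail has only monomials below [mo], so the leading
    coefficient is unchanged. *)
Lemma lead_not_surviving f mo : (0 < k)%N -> (alpha + m <= n)%N ->
  J f -> is_lead w f mo -> ~ surv mo.
Proof.
move=> k0 han Jf [mof lf] Smo.
pose h := f - f@_mo *: 'X_[mo].
have hlt v : v \in msupp h -> drl_lt w v mo.
  move=> vh; apply: lf => [|e].
    move: vh => /msuppB_le; rewrite mem_cat => /orP[//|/msuppZ_le].
    by rewrite msuppX inE => /eqP ->.
  by move: vh; rewrite e mcoeff_msupp mcoeffB mcoeffZ mcoeffX eqxx mulr1 subrr eqxx.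
have [v /hlt vu|g [Jg gS]] := @reduce_poly (fun v => surv v /\ drl_lt w v mo) h.
  have [g [Jg gS]] := reduce_mon v; exists g; split=> // x /gS[Sx xv]; split=> //.
  by case: xv => [-> //|xv]; exact: drl_trans hw _ _ _ xv vu.
pose f' := f@_mo *: 'X_[mo] + g.
have Jf' : J f'.
  have -> : f' = f + (-1) *: (h - g).
    by rewrite scaleN1r opprB /h opprB addrCA [f + _]addrC subrK addrC.
  by apply: JidealD => //; apply: JidealZ.
have f'0 : f' = 0.
  apply: (surviving_indep charF0 hw k0 han Jf') => v /msuppD_le.
  rewrite mem_cat => /orP[/msuppZ_le|/gS[] //].
  by rewrite msuppX inE => /eqP ->.
have := congr1 (mcoeff mo) f'0; rewrite mcoeff0 mcoeffD mcoeffZ mcoeffX eqxx mulr1.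
rewrite (@memN_msupp_eq0 _ _ g) ?addr0; last by apply/negP => /gS[_ /drl_irr].
by move/eqP; rewrite mcoeff_eq0 mof.
Qed.

Lemma is_lead_mulX (f : {mpoly F[nvars n k]}) mo u :
  is_lead w f mo -> is_lead w (f * 'X_[u]) (u + mo)%MM.
Proof.
case=> mof lf; split; first by rewrite (perm_mem (msuppMX _ _)) map_f.
move=> v; rewrite (perm_mem (msuppMX _ _)) => /mapP[v' v'f ->] ne.
by apply: drl_mull; apply: lf => // e; apply: ne; rewrite e.
Qed.

Lemma initial_idealP mo : (0 < k)%N -> (alpha + m <= n)%N ->
  initial_ideal w J 'X_[mo] <-> cond1 mo \/ cond2 alpha m r mo.
Proof.
move=> k0 han; split=> [[l [q [lm [lmP e]]]]|/cond_lead[f [Jf lf]]]; last first.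
  exists 1%N, (fun=> 1), (fun=> mo); split; last by rewrite big_ord1 mul1r.
  move=> _; exists f; split=> //; split=> //; case: lf => mof _.
  by apply: contraTneq mof => ->; rewrite msupp0.
(* Some summand must contain [mo], so [mo] is a multiple of a leading monomial and itself leads a
   multiple of the corresponding element. *)
have /existsP[i] : [exists i, mo \in msupp (q i * 'X_[lm i])].
  apply: contraT => /existsPn h; have := congr1 (mcoeff mo) e.
  rewrite mcoeffX eqxx raddf_sum big1 => [/eqP|i _]; first by rewrite oner_eq0.
  by apply: memN_msupp_eq0.
rewrite (perm_mem (msuppMX _ _)) => /mapP[u _ ->].
have [f [Jf [_ lf]]] := lmP i; apply/not_surviving.
rewrite addmC.
exact: lead_not_surviving k0 han (JidealM _ Jf) (is_lead_mulX u lf).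
Qed.

End Reduction.

Theorem theorem4p2 (F : closedFieldType) (charF0 : [pchar F] =i pred0)
  (n k : nat) (hk1 : (1 <= k)%N) (hkn : (k < n)%N)
  (alpha m r : nat) (hm : (1 <= m)%N) (han : (alpha + m <= n)%N) (hr : (r < m)%N)
  (w : ksub n k -> nat) (hw : linext w) :
  (forall mo : 'X_{1..nvars n k},
     initial_ideal w (Jideal (F:=F) alpha m r) 'X_[mo] <->
     (cond1 mo \/ cond2 alpha m r mo))
  /\
  (forall mo : 'X_{1..nvars n k},
     (initial_ideal w (Jideal (F:=F) alpha m r) 'X_[mo] /\
      forall mo' : 'X_{1..nvars n k}, (mo' <= mo)%MM -> mo' <> mo ->
        ~ initial_ideal w (Jideal (F:=F) alpha m r) 'X_[mo'])
     <->
     ((cond1 mo \/ cond2 alpha m r mo) /\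
      forall mo' : 'X_{1..nvars n k}, (mo' <= mo)%MM -> mo' <> mo ->
        ~ cond1 mo' /\ ~ cond2 alpha m r mo')).
Proof.
have iP mo : initial_ideal w (Jideal (F:=F) alpha m r) 'X_[mo] <->
    cond1 mo \/ cond2 alpha m r mo by apply: initial_idealP.
split=> // mo; rewrite iP; split=> -[cmo min]; split=> // mo' le ne.
  by apply: not_or_and; rewrite -iP; apply: min.
by rewrite iP; apply: and_not_or; apply: min.
Qed.
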